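(* Let $C = 11\cdot 195^2 = 418{,}275$. Let $G_1=(V_1,E_1)$ and $G_2=(V_2,E_2)$ be graphs on $n$ vertices each with $\Delta(G_1),\Delta(G_2)\le n-2$. If $|E_1|+|E_2|+\max\{\Delta(G_1),\Delta(G_2)\}\le 3n-C$, then $G_1$ and $G_2$ pack.
   Context: Two $n$-vertex graphs $G_1=(V_1,E_1)$ and $G_2=(V_2,E_2)$ pack if there is a bijection $f:V_1\to V_2$ such that $uv\in E_1$ implies $f(u)f(v)\notin E_2$. $\Delta(G)$ denotes the maximum degree of $G$. *)

(* Defs.v *)
From mathcomp Require Import all_boot.
Set Implicit Arguments. Unset Strict Implicit. Unset Printing Implicit Defensive.

Definition simple_graph (n : nat) (e : rel 'I_n) : Prop :=
  (forall x, ~~ e x x) /\ (forall x y, e x y = e y x).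

Definition nedges (n : nat) (e : rel 'I_n) : nat :=
  #|[set p : 'I_n * 'I_n | (p.1 < p.2)%N && e p.1 p.2]|.

Definition degree (n : nat) (e : rel 'I_n) (x : 'I_n) : nat :=
  #|[set y | e x y]|.

(* maximum degree (0 for the empty vertex set) *)
Definition maxdeg (n : nat) (e : rel 'I_n) : nat :=
  \max_(x : 'I_n) degree e x.

Definition packs (n : nat) (e1 e2 : rel 'I_n) : Prop :=
  exists f : 'I_n -> 'I_n, bijective f /\
    forall u v, e1 u v -> ~~ e2 (f u) (f v).

Definition C_const : nat := 11 * 195 ^ 2.

(* Main.v *)
Require Import Defs.
From mathcomp Require Import all_boot perm.
From mathcomp Require Import zify.
Set Implicit Arguments. Unset Strict Implicit. Unset Printing Implicit Defensive.

(* Let [D] be the largest degree. If a vertex [x] has degree at least [19n/20], the hypothesis makes both graphs very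
   sparse away from [x]. One then places [x] on a vertex of degree at most 2, together with further vertices, so that no
   constraint on the remaining vertices survives; leaves of [x] serve to absorb the neighbours of the vertices that are
   used. At least three edges per placed vertex disappear, and induction on [n] applies.

   Otherwise a packing is built directly. Call hubs the vertices of degree at least [t], where [5 t^2] is about [n].
   The hubs of each graph are placed on vertices of bounded degree of the other one, in such a way that the hubs do not
   conflict and that the neighbours of a non-hub forbid to it at most [max (n/2) D] positions, and at most [n/5] positions
   up to a bounded number of exceptions. The exceptional vertices are placed next. A bijection extending this partial
   packing with the fewest conflicts then has none, by the swapping argument of Sauer and Spencer.

   Conflicts between hubs are avoided as follows, [G1] having at least as many edges as [G2]. If many vertices of [G2]
   have no hub neighbour, the hubs of [G1] are placed there. If not, [G2] has roughly [n] edges or more, [G1] has at most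
   about [2n], and many vertices of [G2] have exactly one hub neighbour: these form the pool for the hubs of [G1]. Let
   [z1] be the hub with most neighbours in the pool. Its preimage is chosen first, with one hub neighbour (or two, if [D]
   is small), and this hub neighbour alone has to avoid the neighbourhood of [z1]. The other hubs of [G1] are spread over
   the pool by decreasing degree so that no hub of [G2] other than [z1] has too many of them next to it. *)

(** * Matchings and packings *)

Definition nbh (T : finType) (e : rel T) (x : T) : {set T} := [set y | e x y].

Definition degsum (T : finType) (e : rel T) : nat := \sum_x #|nbh e x|.

Lemma in_nbh (T : finType) (e : rel T) x y : (y \in nbh e x) = e x y.
Proof. by rewrite inE. Qed.

Section Matchings.

Variables T1 T2 : finType.
Implicit Types M N : {set T1 * T2}.

(** A partial injection is kept as a set of pairs. The one equation makes it both functional and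
    injective, and its symmetry lets [swap_pairs] exchange the two graphs. *)
Definition matching M : Prop :=
  forall p q, p \in M -> q \in M -> (p.1 == q.1) = (p.2 == q.2).

Definition dom M : {set T1} := [set p.1 | p in M].
Definition ran M : {set T2} := [set p.2 | p in M].

Lemma domP M a : reflect (exists b, (a, b) \in M) (a \in dom M).
Proof.
apply: (iffP imsetP) => [[[a' b] Mp /= ->]|[b Mp]]; first by exists b.
by exists (a, b).
Qed.

Lemma ranP M b : reflect (exists a, (a, b) \in M) (b \in ran M).
Proof.
apply: (iffP imsetP) => [[[a b'] Mp /= ->]|[a Mp]]; first by exists a.
by exists (a, b).
Qed.

Lemma card_dom M : matching M -> #|dom M| = #|M|.
Proof.
move=> mM; apply: card_in_imset => -[a b] [a' b'] Mp Mq /= eq_a.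
by have := mM _ _ Mp Mq; rewrite /= eq_a eqxx => /esym/eqP->.
Qed.

Lemma card_ran M : matching M -> #|ran M| = #|M|.
Proof.
move=> mM; apply: card_in_imset => -[a b] [a' b'] Mp Mq /= eq_b.
by have := mM _ _ Mp Mq; rewrite /= eq_b eqxx => /eqP->.
Qed.

Lemma matching_sub M N : N \subset M -> matching M -> matching N.
Proof. by move=> /subsetP sNM mM p q Np Nq; apply: mM; apply: sNM. Qed.

Lemma matchingU M N : matching M -> matching N ->
  [disjoint dom M & dom N] -> [disjoint ran M & ran N] -> matching (M :|: N).
Proof.
move=> mM mN dD dR.
have cross p q : p \in M -> q \in N -> (p.1 == q.1) = (p.2 == q.2).
  move=> Mp Nq.
  have /negPf-> : p.1 != q.1.
    apply: contraTN dD => /eqP eq_pq; apply/pred0Pn; exists p.1.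
    by rewrite /= imset_f //= eq_pq imset_f.
  have /negPf-> // : p.2 != q.2.
  apply: contraTN dR => /eqP eq_pq; apply/pred0Pn; exists p.2.
  by rewrite /= imset_f //= eq_pq imset_f.
move=> p q /setUP[Mp|Np] /setUP[Mq|Nq]; first exact: mM.
- exact: cross.
- by rewrite eq_sym cross // eq_sym.
- exact: mN.
Qed.

Lemma matching1 a b : matching [set (a, b)].
Proof. by move=> p q /set1P-> /set1P->; rewrite !eqxx. Qed.

Lemma matching0 : matching set0.
Proof. by move=> p q; rewrite inE. Qed.

Lemma dom1 a b : dom [set (a, b)] = [set a].
Proof. by rewrite /dom imset_set1. Qed.

Lemma ran1 a b : ran [set (a, b)] = [set b].
Proof. by rewrite /ran imset_set1. Qed.

Lemma domU M N : dom (M :|: N) = dom M :|: dom N.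
Proof. exact: imsetU. Qed.

Lemma ranU M N : ran (M :|: N) = ran M :|: ran N.
Proof. exact: imsetU. Qed.

Lemma graph_matching (A : {set T1}) (f : T1 -> T2) :
  {in A &, injective f} -> matching [set (a, f a) | a in A].
Proof.
move=> injf p q /imsetP[a Aa ->] /imsetP[a' Aa' ->] /=.
by apply/eqP/eqP => [->//|]; apply: injf.
Qed.

Lemma dom_graph (A : {set T1}) (f : T1 -> T2) : dom [set (a, f a) | a in A] = A.
Proof.
apply/setP=> a; apply/domP/idP=> [[b /imsetP[a' Aa' [-> _]]//]|Aa].
by exists (f a); apply: imset_f.
Qed.

Lemma ran_graph (A : {set T1}) (f : T1 -> T2) :
  ran [set (a, f a) | a in A] = [set f a | a in A].
Proof.
apply/setP=> b; apply/ranP/imsetP=> [[a /imsetP[a' Aa' [_ ->]]]|[a Aa ->]].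
  by exists a'.
by exists a; apply: imset_f.
Qed.

Lemma card_le_inj (A : {set T1}) (B : {set T2}) : #|A| <= #|B| -> (A != set0) ->
  exists f : T1 -> T2, {in A &, injective f} /\ (forall a, a \in A -> f a \in B).
Proof.
move=> leAB /set0Pn[a0 Aa0].
have B0 : 0 < #|B| by apply: leq_trans leAB; rewrite card_gt0; apply/set0Pn; exists a0.
have [b0 Bb0] : exists b0, b0 \in B by apply/set0Pn; rewrite -card_gt0.
exists (fun a => nth b0 (enum B) (index a (enum A))); split=> [a a' Aa Aa' /eqP|a Aa].
  have idx x : x \in A -> index x (enum A) < size (enum B).
    by move=> Ax; rewrite -cardE (leq_trans _ leAB) // cardE index_mem mem_enum.
  rewrite nth_uniq ?enum_uniq ?idx // => /eqP eq_i.
  have nthE x : x \in A -> nth a0 (enum A) (index x (enum A)) = x.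
    by move=> Ax; rewrite nth_index ?mem_enum.
  by rewrite -(nthE a) // eq_i nthE.
by rewrite -mem_enum mem_nth // -cardE (leq_trans _ leAB) // cardE index_mem mem_enum.
Qed.

Lemma matching_exists (A : {set T1}) (B : {set T2}) : #|A| <= #|B| ->
  exists M, [/\ matching M, dom M = A & ran M \subset B].
Proof.
move=> leAB; have [->|A0] := eqVneq A set0.
  exists set0; split; first exact: matching0.
    by rewrite /dom imset0.
  by rewrite /ran imset0 sub0set.
have [f [injf fB]] := card_le_inj leAB A0.
exists [set (a, f a) | a in A]; split; [exact: graph_matching|exact: dom_graph|].
by rewrite ran_graph; apply/subsetP=> b /imsetP[a Aa ->]; apply: fB.
Qed.

Lemma matching_perfect M : matching M -> #|T1| = #|T2| ->
  exists N, [/\ matching N, M \subset N, dom N = setT & ran N = setT].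
Proof.
move=> mM eqT.
have eqC : #|~: dom M| = #|~: ran M| by rewrite [LHS]cardsCs [RHS]cardsCs !setCK card_dom ?card_ran ?eqT.
have [N [mN dN rN]] := matching_exists (eq_leq eqC).
have rN' : ran N = ~: ran M.
  by apply/eqP; rewrite eqEcard rN card_ran // -card_dom // dN eqC leqnn.
exists (M :|: N); split.
- apply: matchingU => //; first by rewrite dN disjoints_subset setCK.
  by rewrite rN' disjoints_subset setCK.
- exact: subsetUl.
- by rewrite domU dN setUCr.
- by rewrite ranU rN' setUCr.
Qed.

Lemma matching_fun M : matching M -> dom M = setT ->
  exists f : T1 -> T2, injective f /\ forall a b, ((a, b) \in M) = (f a == b).
Proof.
move=> mM dM.
have ex a : exists b, (a, b) \in M by apply/domP; rewrite dM inE.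
pose f a := xchoose (ex a).
have fP a : (a, f a) \in M by apply: (xchooseP (ex a)).
exists f; split=> [a a' eq_f|a b].
  by have := mM _ _ (fP a) (fP a'); rewrite /= eq_f eqxx => /eqP.
apply/idP/eqP=> [Mab|<-//].
by have := mM _ _ (fP a) Mab; rewrite /= eqxx => /esym/eqP.
Qed.

End Matchings.

Definition swap_pairs (T1 T2 : finType) (M : {set T1 * T2}) : {set T2 * T1} :=
  [set p | (p.2, p.1) \in M].

Lemma in_swap (T1 T2 : finType) (M : {set T1 * T2}) a b :
  ((b, a) \in swap_pairs M) = ((a, b) \in M).
Proof. by rewrite inE. Qed.

Lemma swapK (T1 T2 : finType) (M : {set T1 * T2}) : swap_pairs (swap_pairs M) = M.
Proof. by apply/setP=> -[a b]; rewrite !inE. Qed.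

Lemma swapU (T1 T2 : finType) (M N : {set T1 * T2}) :
  swap_pairs (M :|: N) = swap_pairs M :|: swap_pairs N.
Proof. by apply/setP=> -[a b]; rewrite !inE. Qed.

Lemma swap_matching (T1 T2 : finType) (M : {set T1 * T2}) :
  matching M -> matching (swap_pairs M).
Proof. by move=> mM [b a] [b' a']; rewrite !in_swap => Mp Mq; have /= := mM _ _ Mp Mq. Qed.

Lemma dom_swap (T1 T2 : finType) (M : {set T1 * T2}) : dom (swap_pairs M) = ran M.
Proof. by apply/setP=> b; apply/domP/ranP=> -[a]; rewrite ?in_swap => ?; exists a; rewrite ?in_swap. Qed.

Lemma ran_swap (T1 T2 : finType) (M : {set T1 * T2}) : ran (swap_pairs M) = dom M.
Proof. by rewrite -dom_swap swapK. Qed.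

Section Packing.

Variables (T1 T2 : finType) (e1 : rel T1) (e2 : rel T2).
Implicit Types M N : {set T1 * T2}.

Definition compat M : Prop :=
  forall p q, p \in M -> q \in M -> e1 p.1 q.1 -> ~~ e2 p.2 q.2.

(** Packing for arbitrary finite vertex types, since the induction passes to subtypes of unplaced
    vertices. *)
Definition packable : Prop :=
  exists M, [/\ matching M, compat M, dom M = setT & ran M = setT].

Hypotheses (sym1 : symmetric e1) (sym2 : symmetric e2).

Lemma compatU M N : compat M -> compat N ->
  (forall p q, p \in M -> q \in N -> e1 p.1 q.1 -> ~~ e2 p.2 q.2) ->
  compat (M :|: N).
Proof.
move=> cM cN cMN p q /setUP[Mp|Np] /setUP[Mq|Nq]; first exact: cM.
- exact: cMN.
- by rewrite sym1 sym2; apply: cMN.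
- exact: cN.
Qed.

End Packing.

Lemma swap_compat (T1 T2 : finType) (e1 : rel T1) (e2 : rel T2) M :
  compat e1 e2 M -> compat e2 e1 (swap_pairs M).
Proof.
move=> cM [b a] [b' a']; rewrite !in_swap /= => Mp Mq; apply: contraTN.
exact: (cM _ _ Mp Mq).
Qed.

Lemma packable_swap (T1 T2 : finType) (e1 : rel T1) (e2 : rel T2) :
  packable e1 e2 -> packable e2 e1.
Proof.
case=> M [mM cM dM rM]; exists (swap_pairs M); split.
- exact: swap_matching.
- exact: swap_compat.
- by rewrite dom_swap.
- by rewrite ran_swap.
Qed.

(** * Completing a partial packing by swaps *)

Lemma card_setU_le (T : finType) (A B : {set T}) : #|A :|: B| <= #|A| + #|B|.
Proof. exact: leq_card_setU. Qed.

Lemma card_bigcup_le (I T : finType) (A : {set I}) (F : I -> {set T}) :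
  #|\bigcup_(i in A) F i| <= \sum_(i in A) #|F i|.
Proof.
elim/big_rec2: _ => [|i m B _ le_Bm]; first by rewrite cards0.
by rewrite (leq_trans (leq_card_setU _ _)) // leq_add2l.
Qed.

Lemma markov_card (T : finType) (A : {set T}) (F : T -> nat) k :
  #|[set x in A | k <= F x]| * k <= \sum_(x in A) F x.
Proof.
rewrite -sum_nat_const (eq_bigl (fun x => (x \in A) && (k <= F x))); last by move=> x; rewrite inE.
rewrite big_mkcondr /=; apply: leq_sum => x _; by case: ifP.
Qed.

(** Double counting of the edges between [A] and [B]. *)
Lemma exchange_nbh (T : finType) (e : rel T) (A B : {set T}) : symmetric e ->
  \sum_(x in A) #|nbh e x :&: B| = \sum_(y in B) #|nbh e y :&: A|.
Proof.
move=> sym.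
have cE (C : {set T}) x : #|nbh e x :&: C| = \sum_(y in C) e x y.
  rewrite -sum1_card big_mkcond [RHS]big_mkcond; apply: eq_bigr => y _.
  by rewrite !inE; case: (e x y); case: (y \in C).
under eq_bigr do rewrite cE.
rewrite exchange_big /=; apply: eq_bigr => y _; rewrite cE.
by apply: eq_bigr => x _; rewrite sym.
Qed.

Section Finishing.

Variables (T1 T2 : finType) (e1 : rel T1) (e2 : rel T2).
Hypotheses (irr1 : irreflexive e1) (sym1 : symmetric e1) (irr2 : irreflexive e2) (sym2 : symmetric e2).

(** Counts, with multiplicity, the positions outside [ran M] adjacent to the image of a neighbour of
    [u]: moving [u] there would create a conflict. *)
Definition reach (U1 U2 : finType) (r1 : rel U1) (r2 : rel U2) (M : {set U1 * U2})
    (f : U1 -> U2) (u : U1) : nat :=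
  \sum_(a in nbh r1 u) #|nbh r2 (f a) :\: ran M|.

Definition extends (U1 U2 : finType) (M : {set U1 * U2}) (f : U1 -> U2) : Prop :=
  forall p, p \in M -> f p.1 = p.2.

Definition conflicts (f : T1 -> T2) : {set T1 * T1} :=
  [set p | e1 p.1 p.2 && e2 (f p.1) (f p.2)].

(* Sauer-Spencer swapping: a bijection extending [M] with a conflict at [u] is improved by exchanging the images of [u] and [w]. *)
Lemma swap_improves (M : {set T1 * T2}) (f : T1 -> T2) (u v w : T1) :
  injective f -> extends M f -> u \notin dom M -> w \notin dom M ->
  e1 u v -> e2 (f u) (f v) -> w != v ->
  (forall a, e1 u a -> ~~ e2 (f a) (f w)) ->
  (forall a, e2 (f u) (f a) -> ~~ e1 a w) ->
  exists f', [/\ injective f', extends M f' & #|conflicts f'| < #|conflicts f|].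
Proof.
move=> injf extf uM wM e1uv e2uv wv Hu Hw.
pose f' a := f (tperm u w a).
have uw : u != w by apply: contraTneq e2uv => uw; rewrite sym2 uw; apply: Hu.
exists f'; split.
- by move=> a b /injf /perm_inj.
- move=> [a b] Mab; rewrite /f' tpermD ?(extf _ Mab) //=.
    by apply: contraNneq uM => ->; apply/domP; exists b.
  by apply: contraNneq wM => ->; apply/domP; exists b.
apply: proper_card; apply/properP; split; last first.
  exists (u, v); first by rewrite inE /= e1uv.
  rewrite inE /= e1uv /= /f' tpermL tpermD //.
    by rewrite sym2; apply: Hu.
  by apply: contraTneq e1uv => ->; rewrite irr1.
apply/subsetP=> -[a b]; rewrite !inE /= /f' => /andP[e1ab].
rewrite e1ab /=; case: tpermP => [au|aw|/eqP ua /eqP wa].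
- case: tpermP => [bu|bw|_ _]; first by rewrite irr2.
    by rewrite au bw sym2.
  by move=> h; have := Hu b; rewrite -au e1ab sym2 h => /(_ isT).
- case: tpermP => [bu|bw|_ _]; first by rewrite aw bu sym2.
    by rewrite irr2.
  by move=> h; have := Hw b; rewrite h sym1 -aw e1ab => /(_ isT).
case: tpermP => [bu|bw|_ _ //].
  by move=> h; have := Hu a; rewrite sym1 -bu e1ab h => /(_ isT).
by move=> h; have := Hw a; rewrite -bw e1ab sym2 h => /(_ isT).
Qed.

(** Start from any bijection extending [M]. As long as there is a conflict at [u], fewer than
    [#|T1|] vertices are unsuitable for an exchange with [u], so some exchange lowers the number of
    conflicts. *)
Lemma finish (M : {set T1 * T2}) (alpha beta : nat) :
  #|T1| = #|T2| -> matching M -> compat e1 e2 M ->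
  (forall f, injective f -> extends M f -> forall u, u \notin dom M -> reach e1 e2 M f u <= alpha) ->
  (forall g, injective g -> extends (swap_pairs M) g ->
     forall b, b \notin ran M -> reach e2 e1 (swap_pairs M) g b <= beta) ->
  #|M| + alpha + beta + 1 < #|T1| ->
  packable e1 e2.
Proof.
move=> eqT mM cM Ha Hb small.
(* Induction on a bound [k] for the number of conflicts. *)
suff main k f : #|conflicts f| < k -> injective f -> extends M f -> packable e1 e2.
  have [N [mN sMN dN _]] := matching_perfect mM eqT.
  have [f [injf fN]] := matching_fun mN dN.
  apply: (main _ f (ltnSn _) injf) => -[a b] Mab.
  by apply/eqP; rewrite -fN; apply: (subsetP sMN).
elim: k f => // k IHk f; rewrite ltnS => le_k injf extf.
have [c0|[[u v] uv]] := set_0Vmem (conflicts f).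
  exists [set (a, f a) | a in [set: T1]]; split.
  - by apply: graph_matching => a b _ _; apply: injf.
  - move=> p q /imsetP[a _ ->] /imsetP[b _ ->] /= e1ab.
    apply: contraTN isT => e2ab; have := in_set0 (a, b).
    by rewrite -c0 inE /= e1ab e2ab.
  - exact: dom_graph.
  - rewrite ran_graph; apply/eqP; rewrite eqEcard subsetT cardsT -eqT /=.
    by rewrite card_imset // cardsT.
(* [M] is compatible, so an edge in conflict has an end outside [dom M]. *)
wlog uM : u v uv / u \notin dom M.
  move=> hw; have [|uM] := boolP (u \in dom M); last exact: (hw u v).
  have [vM uM|vM _] := boolP (v \in dom M); last first.
    by apply: (hw v u) => //; move: uv; rewrite !inE /= sym1 sym2.
  move: uv; rewrite inE /= => /andP[e1uv].
  case/domP: uM => b Mub; case/domP: vM => c Mvc.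
  by rewrite (extf _ Mub) (extf _ Mvc) /= (negPf (cM _ _ Mub Mvc e1uv)).
move: uv; rewrite inE /= => /andP[e1uv e2uv].
have bijf : bijective f by apply: inj_card_bij => //; rewrite eqT.
case: bijf => g fK gK.
have injg : injective g by apply: can_inj gK.
have extg : extends (swap_pairs M) g.
  by move=> [b a]; rewrite in_swap => /extf /= <-.
have fuM : f u \notin ran M.
  apply: contra uM => /ranP[a Mau]; apply/domP; exists (f u).
  by have /= := extf _ Mau => /injf eq_au; rewrite -{1}eq_au.
(* The vertices not to be exchanged with [u]: the placed ones, [v], those whose position would
   conflict with a neighbour of [u], and those that would conflict themselves when moved to
   [f u]. *)
pose bad := dom M :|: [set v] :|: [set g b | b in \bigcup_(a in nbh e1 u) (nbh e2 (f a) :\: ran M)]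
   :|: \bigcup_(b in nbh e2 (f u)) (nbh e1 (g b) :\: dom M).
have ltbad : #|bad| < #|T1|.
  apply: leq_ltn_trans small; rewrite /bad.
  have le_im : #|[set g b | b in \bigcup_(a in nbh e1 u) (nbh e2 (f a) :\: ran M)]| <= alpha.
    apply: leq_trans (leq_imset_card _ _) (leq_trans (card_bigcup_le _ _) _).
    exact: Ha.
  have le_cup : #|\bigcup_(b in nbh e2 (f u)) (nbh e1 (g b) :\: dom M)| <= beta.
    apply: leq_trans (card_bigcup_le _ _) _.
    by have := Hb g injg extg (f u) fuM; rewrite /reach ran_swap.
  rewrite -(card_dom mM); apply: leq_trans (leq_card_setU _ _) _.
  rewrite addnAC; apply: leq_add le_cup; rewrite addnAC.
  apply: leq_trans (leq_card_setU _ _) (leq_add _ le_im).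
  by apply: leq_trans (leq_card_setU _ _) _; rewrite cards1.
have /subsetPn[w _ wbad] : ~~ ([set: T1] \subset bad).
  by apply: contraL ltbad => /subset_leq_card; rewrite cardsT -leqNgt.
move: wbad; rewrite !inE !negb_or => /andP[/andP[/andP[wM wv] w1] w2].
have [f' [injf' extf' lt_f']] : exists f', [/\ injective f', extends M f' & #|conflicts f'| < #|conflicts f|].
  apply: (swap_improves injf extf uM wM e1uv e2uv wv).
    move=> a e1ua; apply: contra w1 => e2aw; apply/imsetP; exists (f w); last by rewrite fK.
    apply/bigcupP; exists a; rewrite ?inE //= e2aw andbT.
    apply: contra wM => /ranP[c Mcw]; apply/domP; exists (f w).
    by have /= := extf _ Mcw => /injf eq_cw; rewrite -{1}eq_cw.
  move=> a e2ua; apply: contra w2 => e1aw; apply/bigcupP; exists (f a); rewrite ?inE //=.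
  by rewrite fK e1aw andbT.
by apply: IHk injf' extf'; apply: leq_trans le_k.
Qed.

End Finishing.

(** * Removing a closed set of placed vertices *)

(* [D] is any upper bound for the degrees, and [degsum] counts every edge twice. *)
Definition packing_bound (n : nat) : Prop :=
  forall (T1 T2 : finType) (e1 : rel T1) (e2 : rel T2) (D : nat),
    irreflexive e1 -> symmetric e1 -> irreflexive e2 -> symmetric e2 ->
    #|T1| = n -> #|T2| = n ->
    (forall x, #|nbh e1 x| <= D) -> (forall x, #|nbh e2 x| <= D) ->
    (forall x, #|nbh e1 x| + 2 <= n) -> (forall x, #|nbh e2 x| + 2 <= n) ->
    degsum e1 + degsum e2 + 2 * D + 2 * C_const <= 6 * n ->
    packable e1 e2.

Definition restr (T : finType) (e : rel T) (S : {set T}) : rel {x : T | x \notin S} :=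
  fun a b => e (val a) (val b).
Arguments restr {T} e S.

Section Restriction.

Variables (T : finType) (e : rel T) (S : {set T}).

Lemma card_restr : #|{: {x : T | x \notin S}}| = #|T| - #|S|.
Proof. by rewrite card_sig -(cardsC S) addKn; apply: eq_card => x; rewrite !inE. Qed.

Lemma nbh_restr a : #|nbh (restr e S) a| = #|nbh e (val a) :\: S|.
Proof.
rewrite -(card_imset _ val_inj); apply: eq_card => y; rewrite !inE.
apply/imsetP/andP=> [[b]|[yS eay]]; first by rewrite inE => eab ->; rewrite (valP b).
by exists (Sub y yS); rewrite ?inE.
Qed.

Lemma degsum_restr : degsum (restr e S) = \sum_(x in ~: S) #|nbh e x :\: S|.
Proof.
rewrite /degsum (eq_bigl (fun x => x \notin S)); last by move=> x; rewrite inE.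
rewrite [RHS](reindex_omap (val : {x : T | x \notin S} -> T) insub) => [|x xS /=]; last by rewrite insubT.
apply: eq_big => [a|a _]; last by rewrite nbh_restr.
by rewrite valK (valP a) /= eqxx.
Qed.

Lemma degsum_restr_le : degsum (restr e S) <= degsum e.
Proof.
rewrite degsum_restr /degsum [X in _ <= X](bigID (mem (~: S))) /=.
apply: leq_trans (leq_addr _ _); apply: leq_sum => x _.
exact: subset_leq_card (subsetDl _ _).
Qed.

(** Deleting [S] destroys at least the edges at [x], and each of them is counted at both ends in
    [degsum]. *)
Lemma degsum_restr_vertex x : irreflexive e -> symmetric e -> x \in S ->
  degsum (restr e S) + 2 * #|nbh e x| <= degsum e.
Proof.
move=> irr sym xS; rewrite degsum_restr /degsum [X in _ <= X](bigD1 x) //= mulSn mul1n addnCA leq_add2l.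
have -> : #|nbh e x| = \sum_(y | y != x) e y x.
  rewrite -sum1_card big_mkcond [RHS]big_mkcond; apply: eq_bigr => y _.
  by rewrite inE sym; case: eqP => [->|_]; [rewrite irr|case: (e y x)].
rewrite big_mkcond [X in _ + X]big_mkcond [X in _ <= X]big_mkcond -big_split.
apply: leq_sum => y _ /=; rewrite !inE; have [->|yx] /= := eqVneq y x; first by rewrite xS.
case: (boolP (y \in S)) => yS /=.
  rewrite add0n; case: (boolP (e y x)) => // eyx.
  by rewrite card_gt0; apply/set0Pn; exists x; rewrite inE.
case: (boolP (e y x)) => eyx; last by rewrite addn0 subset_leq_card // subsetDl.
rewrite addn1; apply: proper_card; apply/properP; split; first exact: subsetDl.
by exists x; rewrite !inE // xS.
Qed.

End Restriction.

(* Every pair of [M] has all neighbours of one of its sides in [M], so it imposes no constraint on the vertices left over. *)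
Lemma clean_reduction (n : nat) (T1 T2 : finType) (e1 : rel T1) (e2 : rel T2)
    (M : {set T1 * T2}) (x : T1) (D : nat) :
  (forall k, k < n -> packing_bound k) ->
  irreflexive e1 -> symmetric e1 -> irreflexive e2 -> symmetric e2 ->
  #|T1| = n -> #|T2| = n ->
  (forall v, #|nbh e1 v| <= D) -> (forall v, #|nbh e2 v| <= D) ->
  degsum e1 + degsum e2 + 2 * D + 2 * C_const <= 6 * n ->
  matching M -> compat e1 e2 M -> x \in dom M -> #|nbh e1 x| = D -> 3 * #|M| <= D ->
  (forall a b, (a, b) \in M -> nbh e1 a \subset dom M \/ nbh e2 b \subset ran M) ->
  (forall v, v \notin dom M -> #|nbh e1 v :\: dom M| + 2 + #|M| <= n) ->
  (forall v, v \notin ran M -> #|nbh e2 v :\: ran M| + 2 + #|M| <= n) ->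
  packable e1 e2.
Proof.
move=> IHn irr1 sym1 irr2 sym2 cT1 cT2 D1 D2 bnd mM cM xM dx leMD clean deg1 deg2.
have M0 : 0 < #|M| by rewrite -(card_dom mM) card_gt0; apply/set0Pn; exists x.
have leMn : #|M| <= n by rewrite -(card_dom mM) -cT1 max_card.
have ltn : n - #|M| < n by lia.
have [||||||v|v|v|v||N [mN cN dN rN]] := IHn _ ltn _ _ (restr e1 (dom M)) (restr e2 (ran M)) D.
- by move=> v; apply: irr1.
- by move=> v w; apply: sym1.
- by move=> v; apply: irr2.
- by move=> v w; apply: sym2.
- by rewrite card_restr card_dom // cT1.
- by rewrite card_restr card_ran // cT2.
- by rewrite nbh_restr; apply: leq_trans (D1 (val v)); rewrite subset_leq_card // subsetDl.
- by rewrite nbh_restr; apply: leq_trans (D2 (val v)); rewrite subset_leq_card // subsetDl.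
- by rewrite nbh_restr; have := deg1 _ (valP v); lia.
- by rewrite nbh_restr; have := deg2 _ (valP v); lia.
(* The [D] edges at [x] disappear, which lowers the degree sum by [2 * D], at least [6 * #|M|]:
   exactly what the right-hand side [6 * n] loses. *)
- have := degsum_restr_vertex irr1 sym1 xM; have := degsum_restr_le e2 (ran M).
  by rewrite dx; lia.
pose N' := [set (val p.1, val p.2) | p in N].
have inN' a b : (val a, val b) \in N' = ((a, b) \in N).
  apply/imsetP/idP => [[[a' b'] Np [/val_inj-> /val_inj->]]//|Nab].
  by exists (a, b).
have N'P p : p \in N' -> exists a b, (a, b) \in N /\ p = (val a, val b).
  by case/imsetP=> -[a b] Nab ->; exists a, b.
have dN' : dom N' = ~: dom M.
  apply/setP=> v; rewrite !inE; apply/idP/idP=> [/domP[b /N'P[a' [b' [_ [-> _]]]]]|vM].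
    exact: (valP a').
  have : Sub v vM \in dom N by rewrite dN inE.
  by case/domP=> b Nvb; apply/domP; exists (val b); rewrite -[v]/(val (Sub v vM : {x | x \notin dom M})) inN'.
have rN' : ran N' = ~: ran M.
  apply/setP=> v; rewrite !inE; apply/idP/idP=> [/ranP[b /N'P[a' [b' [_ [_ ->]]]]]|vM].
    exact: (valP b').
  have : Sub v vM \in ran N by rewrite rN inE.
  by case/ranP=> b Nvb; apply/ranP; exists (val b); rewrite -[v]/(val (Sub v vM : {x | x \notin ran M})) inN'.
exists (M :|: N'); split.
- apply: matchingU => //.
  + move=> p q /N'P[a [b [Nab ->]]] /N'P[a' [b' [Nab' ->]]] /=.
    by rewrite !(inj_eq val_inj); have := mN _ _ Nab Nab'.
  + by rewrite disjoint_sym dN' disjoints_subset.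
  + by rewrite disjoint_sym rN' disjoints_subset.
- apply: compatU => //.
  + move=> p q /N'P[a [b [Nab ->]]] /N'P[a' [b' [Nab' ->]]] /=.
    exact: cN _ _ Nab Nab'.
  + move=> [a b] q Mab /N'P[a' [b' [Nab' ->]]] /= e1a.
    have [s1|s2] := clean _ _ Mab.
      by have := valP a'; rewrite (subsetP s1) ?inE.
    by apply: contraL (valP b') => e2b; rewrite negbK (subsetP s2) ?inE.
- by rewrite domU dN' setUCr.
- by rewrite ranU rN' setUCr.
Qed.

Lemma degree_le_degsum (T : finType) (e : rel T) v :
  irreflexive e -> symmetric e -> 2 * #|nbh e v| <= degsum e.
Proof.
by move=> irr sym; have := degsum_restr_vertex irr sym (in_setT v); apply: leq_trans; apply: leq_addl.
Qed.

(** * Degree sums, leaves and independent sets *)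

Section Degrees.

Variables (T : finType) (e : rel T).
Hypotheses (irr : irreflexive e) (sym : symmetric e).

(** Delete [x] and apply the bound for one degree to [v] in the rest; the two stars share no
    edge. *)
Lemma two_degrees v x : v != x -> 2 * #|nbh e v :\ x| + 2 * #|nbh e x| <= degsum e.
Proof.
move=> vx; have := degsum_restr_vertex irr sym (set11 x).
have vS : v \notin [set x] by rewrite inE.
have := @degree_le_degsum _ (restr e [set x]) (Sub v vS) (fun a => irr _) (fun a b => sym _ _).
rewrite nbh_restr SubK => le_v; apply: leq_trans; rewrite leq_add2r; exact: le_v.
Qed.

Lemma sum_setT_degsum : \sum_(v in [set: T]) #|nbh e v| = degsum e.
Proof. by apply: eq_bigl => v; rewrite inE. Qed.

Lemma degsum_sub (A : {set T}) : \sum_(v in A) #|nbh e v| <= degsum e.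
Proof. by rewrite /degsum [X in _ <= X](bigID (mem A)) /= leq_addr. Qed.

Lemma degsum_split x : degsum e = #|nbh e x| + \sum_(v in nbh e x) #|nbh e v|
  + \sum_(v in ~: (x |: nbh e x)) #|nbh e v|.
Proof.
rewrite /degsum (bigD1 x) //= -addnA; congr (_ + _).
rewrite (bigID (mem (nbh e x))) /=; congr (_ + _); apply: eq_bigl => v.
  by rewrite inE; case: eqP => [->|//]; rewrite irr.
by rewrite !inE negb_or.
Qed.

Definition pendant (x : T) : {set T} := [set v | e x v & #|nbh e v| == 1].

(** A neighbour of [x] that is not a leaf contributes at least 2 to the degree sum, so a small
    [degsum e] forces many leaves at [x]. *)
Lemma degsum_pendant x :
  3 * #|nbh e x| + \sum_(v in ~: (x |: nbh e x)) #|nbh e v| <= degsum e + #|pendant x|.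
Proof.
have cP : #|pendant x| = \sum_(v in nbh e x) (#|nbh e v| == 1).
  rewrite -sum1_card (eq_bigl (fun v => (v \in nbh e x) && (#|nbh e v| == 1))).
    by rewrite big_mkcondr; apply: eq_bigr => v _; case: eqP.
  by move=> v; rewrite !inE.
have le2 : 2 * #|nbh e x| <= \sum_(v in nbh e x) #|nbh e v| + #|pendant x|.
  rewrite cP -big_split mulnC -sum_nat_const; apply: leq_sum => v; rewrite inE => exv.
  have : 0 < #|nbh e v| by rewrite card_gt0; apply/set0Pn; exists x; rewrite inE sym.
  by rewrite /=; case: eqP => [->//|]; lia.
by rewrite [X in _ <= X + _](degsum_split x); lia.
Qed.

Lemma sum_far_degrees x :
  2 * #|nbh e x| + \sum_(v in ~: (x |: nbh e x)) #|nbh e v| <= degsum e.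
Proof.
have := degsum_pendant x.
have : #|pendant x| <= #|nbh e x|.
  by apply: subset_leq_card; apply/subsetP=> v; rewrite !inE => /andP[].
by lia.
Qed.

(** Greedy choice: each chosen vertex rules out itself and at most [kappa] neighbours. *)
Lemma independent_subset (A : {set T}) k kappa :
  (forall v, v \in A -> #|nbh e v| <= kappa) -> k * kappa.+1 <= #|A| ->
  exists I : {set T}, [/\ I \subset A, #|I| = k & forall u v, u \in I -> v \in I -> ~~ e u v].
Proof.
move=> degA; elim: k => [|k IHk] cA.
  by exists set0; rewrite sub0set cards0; split=> // u v; rewrite inE.
have [|I [sIA cI indI]] := IHk; first by lia.
have lt_cov : #|\bigcup_(u in I) (u |: nbh e u)| < #|A|.
  apply: leq_ltn_trans (card_bigcup_le _ _) _; apply: leq_trans cA.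
  rewrite mulSn addnC -addn1 leq_add //.
  rewrite -cI -sum_nat_const; apply: leq_sum => u uI.
  by rewrite cardsU1 -add1n leq_add ?leq_b1 // degA // (subsetP sIA).
have /subsetPn[a Aa aN] : ~~ (A \subset \bigcup_(u in I) (u |: nbh e u)).
  by apply: contraL lt_cov => /subset_leq_card; rewrite -leqNgt.
have aI u : u \in I -> (a != u) && ~~ e u a.
  move=> uI; rewrite -negb_or; apply: contra aN => h.
  by apply/bigcupP; exists u; rewrite ?inE // eq_sym (eq_sym u).
exists (a |: I); split.
- by rewrite subUset sub1set Aa.
- rewrite cardsU1 cI; case: (boolP (a \in I)) => // /aI; by rewrite eqxx.
- move=> u v; rewrite !inE => /orP[/eqP->|uI] /orP[/eqP->|vI].
  + by rewrite irr.
  + by rewrite sym; case/andP: (aI _ vI).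
  + by case/andP: (aI _ uI).
  + exact: indI.
Qed.

Definition leaf v := #|nbh e v| == 1.

Lemma leaf_nbh v z : leaf v -> e v z -> nbh e v = [set z].
Proof. by move=> /cards1P[z' vE] evz; have := in_nbh e v z; rewrite vE inE evz => /eqP->. Qed.

(** Every leaf is charged to its only neighbour, which is not a leaf; both counts become sums over
    the non-leaves, to be compared term by term. *)
Lemma leaf_decomposition :
  (forall u v, leaf u -> leaf v -> ~~ e u v) ->
  #|T| = \sum_(v | ~~ leaf v) (1 + #|nbh e v :&: [set u | leaf u]|) /\
  degsum e = \sum_(v | ~~ leaf v) (#|nbh e v| + #|nbh e v :&: [set u | leaf u]|).
Proof.
move=> noadj; pose Lf := [set u | leaf u].
have cL : #|Lf| = \sum_(v | ~~ leaf v) #|nbh e v :&: Lf|.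
  rewrite (eq_bigl (fun v => v \in ~: Lf)); last by move=> v; rewrite !inE.
  rewrite -exchange_nbh // -sum1_card; apply: eq_bigr => u; rewrite inE => uL.
  rewrite -(eqP uL); congr #|pred_of_set _|; apply/esym/setIidPl/subsetP => v.
  by rewrite !inE => euv; apply: contraL euv => vL; apply: noadj.
rewrite !big_split /= -cL; split.
  rewrite -(cardsC Lf) addnC; congr (_ + _); rewrite -sum1_card.
  by apply: eq_bigl => v; rewrite !inE.
rewrite /degsum (bigID leaf) /= addnC; congr (_ + _).
rewrite -sum1_card; apply: eq_big => [v|v /eqP//]; by rewrite inE.
Qed.

(** Disjoint stars with [q] leaves attain equality. After charging the leaves, a non-leaf without
    leaves has degree at least 2, and one with [l] leaves has degree at least both [l] and [q]. For
    [q = 1] two leaves may be adjacent, but then the claim only says that all degrees are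
    positive. *)
Lemma degsum_leaf_support q : 0 < q -> (forall v, 0 < #|nbh e v|) ->
  (forall u v, leaf u -> e u v -> q <= #|nbh e v|) -> 2 * q * #|T| <= q.+1 * degsum e.
Proof.
move=> q0 deg1 supp; have [|q2] := leqP q 1.
  move=> q1; have -> : q = 1 by lia.
  rewrite muln1 leq_mul2l /= -sum1_card; apply: leq_sum => v _; exact: deg1.
have noadj u v : leaf u -> leaf v -> ~~ e u v.
  by move=> uL vL; apply/negP => /(supp _ _ uL); rewrite (eqP vL); lia.
have [-> ->] := leaf_decomposition noadj.
rewrite !big_distrr /=; apply: leq_sum => v vL.
set l := #|_ :&: _|.
have ld : l <= #|nbh e v| by rewrite subset_leq_card // subsetIl.
have d1 : #|nbh e v| != 1 by [].
have := deg1 v; have [l0|] := posnP l; first by rewrite l0; nia.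
rewrite {1}/l card_gt0 => /set0Pn[u]; rewrite !inE => /andP[evu uL] _.
by have := supp u v uL; rewrite sym evu => /(_ isT); nia.
Qed.

(** For large [q]: only vertices of degree at least [q] carry leaves, [p] is their number at most,
    and each of them makes the average degree fall short of 2 by a bounded amount. *)
Lemma degsum_big_support q : 1 < q -> (forall v, 0 < #|nbh e v|) ->
  (forall u v, leaf u -> e u v -> q <= #|nbh e v|) ->
  exists2 p, p * q <= degsum e & 2 * #|T| <= degsum e + 2 * p.
Proof.
move=> q2 deg1 supp.
have noadj u v : leaf u -> leaf v -> ~~ e u v.
  by move=> uL vL; apply/negP => /(supp _ _ uL); rewrite (eqP vL); lia.
exists #|[set v in [set: T] | q <= #|nbh e v|]|.
  by rewrite -sum_setT_degsum; apply: markov_card.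
have [-> ->] := leaf_decomposition noadj.
apply: (@leq_trans (\sum_(v | ~~ leaf v) (#|nbh e v| + #|nbh e v :&: [set u | leaf u]|
    + 2 * (q <= #|nbh e v|)))).
  rewrite big_distrr /=; apply: leq_sum => v vL; set l := #|_ :&: _|.
  have ld : l <= #|nbh e v| by rewrite subset_leq_card // subsetIl.
  have d1 : #|nbh e v| != 1 by [].
  have := deg1 v; have [l0|] := posnP l; first by rewrite l0; lia.
  rewrite {1}/l card_gt0 => /set0Pn[u]; rewrite !inE => /andP[evu uL] _.
  by have := supp u v uL; rewrite sym evu => /(_ isT) ->; lia.
rewrite big_split leq_add2l -big_distrr leq_mul2l /=.
rewrite -sum1_card big_mkcond [X in _ <= X]big_mkcond; apply: leq_sum => v _.
by rewrite !inE; case: (leaf v) => /=; case: (q <= _).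
Qed.

End Degrees.

(** * A vertex adjacent to almost everything *)

Lemma C_constE : C_const = 11 * (195 * 195).
Proof. by rewrite /C_const -mulnn. Qed.

Section Dominating.

Variables (n D : nat) (T1 T2 : finType) (e1 : rel T1) (e2 : rel T2) (x : T1).
Hypotheses (IHn : forall k, k < n -> packing_bound k).
Hypotheses (irr1 : irreflexive e1) (sym1 : symmetric e1).
Hypotheses (irr2 : irreflexive e2) (sym2 : symmetric e2).
Hypotheses (cT1 : #|T1| = n) (cT2 : #|T2| = n).
Hypotheses (D1 : forall v, #|nbh e1 v| <= D) (D2 : forall v, #|nbh e2 v| <= D).
Hypotheses (dx : #|nbh e1 x| = D) (leDn : D + 2 <= n).
Hypothesis (bnd : degsum e1 + degsum e2 + 2 * D + 2 * C_const <= 6 * n).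

Let far : {set T1} := ~: (x |: nbh e1 x).

Lemma card_far : #|far| = n - D.+1.
Proof. by rewrite /far -cT1 -(cardsC (x |: nbh e1 x)) cardsU1 inE irr1 dx add1n addKn. Qed.

Lemma rest_degree1 v : v != x -> 2 * #|nbh e1 v :\ x| + 2 * D <= degsum e1.
Proof. by move=> vx; have := two_degrees irr1 sym1 vx; rewrite dx. Qed.

(** The single pair [(x, y)] is enough: [y] imposes no constraint and [D] edges leave with [x]. *)
Lemma dominating_isolated y : 3 <= D -> nbh e2 y = set0 -> packable e1 e2.
Proof.
move=> D3 y0; apply: (@clean_reduction n _ _ _ _ [set (x, y)] x D) => //.
- exact: matching1.
- by move=> p q /set1P-> /set1P->; rewrite irr1.
- by rewrite dom1 set11.
- by rewrite cards1 muln1.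
- by move=> a b /set1P[_ ->]; right; rewrite y0 sub0set.
- move=> v; rewrite dom1 !inE cards1 => /rest_degree1.
  have := D1 v; have := subset_leq_card (subsetDl (nbh e1 v) [set x]).
  by have := bnd; rewrite C_constE; lia.
- move=> v; rewrite ran1 !inE cards1 => _.
  have := D2 v; have := subset_leq_card (subsetDl (nbh e2 v) [set y]).
  have := degree_le_degsum v irr2 sym2; have := degree_le_degsum x irr1 sym1.
  by have := bnd; rewrite C_constE; lia.
Qed.

Hypothesis big : 19 * n <= 20 * D.

(* [x] goes to the leaf [y], a non-neighbour of [x] to [z], and the other neighbours of [z] are covered by leaves of [x]. *)
Lemma dominating_leaf y z : leaf e2 y -> e2 y z ->
  (forall v, 0 < #|nbh e2 v|) ->
  (forall u v, leaf e2 u -> e2 u v -> #|nbh e2 z| <= #|nbh e2 v|) ->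
  4 * #|nbh e2 z| <= n -> degsum e2 + 6 <= 2 * n -> packable e1 e2.
Proof.
have := bnd; rewrite C_constE => bnd' yL eyz deg1 supp; set q := #|nbh e2 z| => q4 s2n.
have q0 : 0 < q := deg1 z.
have s2 : 2 * q * n <= q.+1 * degsum e2 by rewrite -cT2; apply: degsum_leaf_support.
(* With [k] the quotient of [n] by [q + 1], the bound of [degsum_leaf_support] becomes linear. *)
have [k s2' [k2 k3 k4]] : exists2 k, 2 * n <= degsum e2 + 2 * k.+1 &
    [/\ 2 * k <= n, 1 < q -> 3 * k <= n & 2 < q -> 4 * k <= n].
  exists (n %/ q.+1); first by have := ltn_ceil n (ltn0Sn q); clear - s2; nia.
  have := leq_divM n q.+1; move: (n %/ _) => k lek.
  by split=> [|q2|q3]; apply: leq_trans lek; rewrite mulnC leq_mul2l ltnS ?q0 ?q2 ?q3 orbT.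
have leqD : 3 * q.+1 <= D by clear - q4 big leDn q0; lia.
have aux a b : a <= b -> 2 * b + 2 * D <= degsum e1 -> a + 2 + q.+1 <= n.
  have q_leq : q <= 1 \/ 3 * k <= n by case: (leqP q 1) => [|/k3]; [left|right].
  clear - bnd' s2' k2 q_leq q4 big leDn q0; case: q_leq => *; lia.
clear s2.
have pend := degsum_pendant irr1 sym1 x.
have nbhy : nbh e2 y = [set z] := leaf_nbh yL eyz.
have yz : y != z by apply: contraTneq eyz => ->; rewrite irr2.
have [w wfar] : exists w, w \in far by apply/set0Pn; rewrite -card_gt0 card_far; lia.
have [wx xw] : w != x /\ ~~ e1 x w by move: wfar; rewrite !inE negb_or => /andP[].
have ez : y \in nbh e2 z by rewrite inE sym2.
have cB : #|nbh e2 z :\ y| = q.-1 by rewrite [q](cardsD1 y) ez.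
(* [x] must have enough leaves to cover the neighbours of [z] other than [y]. *)
have : #|nbh e2 z :\ y| <= #|pendant e1 x|.
  rewrite cB; have [q1|q2] := leqP q 1; first by lia.
  have [q3|q3] := leqP q 2; rewrite dx in pend; first by have := k3 q2; lia.
  by have := k4 q3; lia.
case/matching_exists => N [mN dN rN].
pose M := [set (x, y)] :|: [set (w, z)] :|: swap_pairs N.
have pendP l : l \in pendant e1 x -> nbh e1 l = [set x].
  by rewrite inE => /andP[exl lL]; apply: leaf_nbh lL _; rewrite sym1.
have pendE l v : l \in pendant e1 x -> e1 l v = (v == x).
  by move=> /pendP lE; rewrite -(in_nbh e1 l) lE inE.
have xpend : x \notin pendant e1 x by rewrite inE irr1.
have wpend : w \notin pendant e1 x by rewrite inE negb_and xw.
have NP l b : (b, l) \in N -> l \in pendant e1 x /\ (b != y) && e2 z b.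
  move=> Nbl; split; first by apply: (subsetP rN); apply/ranP; exists b.
  have : b \in dom N by apply/domP; exists l.
  by rewrite dN !inE.
have mM : matching M.
  apply: matchingU; first 1 last.
  - exact: swap_matching.
  - rewrite dom_swap disjoint_sym disjoints_subset; apply: subset_trans rN _.
    apply/subsetP=> l lp; rewrite domU !dom1 !inE negb_or.
    by rewrite (memPn xpend) // (memPn wpend).
  - rewrite ran_swap dN disjoint_sym disjoints_subset; apply/subsetP=> b.
    rewrite ranU !ran1 !inE negb_or => /andP[-> ezb].
    by apply: contraTneq ezb => ->; rewrite irr2.
  apply: matchingU; [exact: matching1|exact: matching1|rewrite !dom1|rewrite !ran1];
    by rewrite disjoints1 inE // eq_sym.
have cM : #|M| = q.+1.
  rewrite -(card_ran mM) !ranU !ran1 ran_swap dN -setUA setUCA.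
  rewrite [[set y] :|: _]setD1K // cardsU1 inE irr2 add1n //.
have domM v : v \notin dom M -> v != x.
  by apply: contraNneq => ->; rewrite !domU !dom1 !inE eqxx.
have zran : z \in ran M by rewrite !ranU !ran1 !inE eqxx orbT.
have nbhz : nbh e2 z \subset ran M.
  apply/subsetP=> b; rewrite in_nbh => ezb; rewrite !ranU !ran1 ran_swap dN !inE ezb.
  by case: (b == y) => //=; rewrite orbT.
apply: (@clean_reduction n _ _ _ _ M x D) => //.
- apply: compatU => //.
  + apply: compatU => // p q'; do 2?[move=> /set1P->]; rewrite /= ?irr1 //.
    by rewrite (negPf xw).
  + move=> [l b] [l' b']; rewrite !in_swap /= => /NP[lp _] /NP[lp' _].
    by rewrite pendE // => /eqP l'x; have := xpend; rewrite -{1}l'x lp'.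
  + move=> [a c] [l b] /setUP[]/set1P[-> ->]; rewrite in_swap /= => /NP[lp /andP[yb ezb]].
      move=> _; rewrite -(in_nbh e2 y) nbhy inE; apply: contraTneq ezb => ->; by rewrite irr2.
    by rewrite sym1 pendE // (negPf wx).
- by rewrite !domU !dom1 !inE eqxx.
- by rewrite cM.
- move=> a b /setUP[/setUP[]/set1P[-> ->]|].
  + by right; rewrite nbhy sub1set.
  + by right.
  + rewrite in_swap => /NP[/pendP-> _]; left.
    by rewrite sub1set !domU !dom1 !inE eqxx.
- move=> v vM; have := rest_degree1 (domM _ vM).
  have : #|nbh e1 v :\: dom M| <= #|nbh e1 v :\ x|.
    apply/subset_leq_card/setDS; by rewrite sub1set !domU !dom1 !inE eqxx.
  by rewrite cM => lev le_rest; apply: aux lev le_rest.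
- move=> v vM; have vz : v != z by apply: contraNneq vM => ->.
  have := two_degrees irr2 sym2 vz; rewrite -/q cM.
  have : #|nbh e2 v :\: ran M| <= #|nbh e2 v :\ z| by apply/subset_leq_card/setDS; rewrite sub1set.
  by move: bnd' s2' q4 big leDn s2n; clear; lia.
Qed.

(* [x] goes to [y], the neighbours of [y] are covered by [W], the neighbours of [W] go to vertices of [Av], whose neighbours are in turn covered by leaves of [x]. *)
Lemma dominating_core y (W : {set T1 * T2}) (Av : {set T2}) :
  matching W -> ran W = nbh e2 y -> #|nbh e2 y| <= 2 ->
  (forall w, w \in dom W -> w \in far /\ #|nbh e1 w| <= 7) ->
  (forall w w', w \in dom W -> w' \in dom W -> ~~ e1 w w') ->
  (forall b, b \in Av -> [/\ b \notin nbh e2 y, b != y, #|nbh e2 b| <= 11 &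
     [disjoint nbh e2 b & nbh e2 y]]) ->
  168 <= #|Av| -> 154 <= #|pendant e1 x| -> 513 <= D ->
  (forall v, v != x -> #|nbh e1 v :\ x| + 173 <= n) ->
  (forall v, #|nbh e2 v| + 173 <= n) -> packable e1 e2.
Proof.
move=> mW rW cy Wfar Wind AvP cAv cpend D513 deg1 deg2.
have cW : #|dom W| <= 2 by rewrite card_dom // -card_ran // rW.
pose U := \bigcup_(w in dom W) nbh e1 w.
have cU : #|U| <= 14.
  apply: leq_trans (card_bigcup_le _ _) _; apply: (@leq_trans (\sum_(w in dom W) 7)).
    by apply: leq_sum => w /Wfar[].
  by rewrite sum_nat_const; move: cW; clear; lia.
(* [U] has at most [2 * 7 = 14] vertices, and [168 = 14 * 12] vertices of degree at most 11 contain
   14 independent ones. These have at most [154 = 14 * 11] neighbours. *)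
have [|I [sIA cI indI]] := @independent_subset _ e2 irr2 sym2 Av #|U| 11 (fun b h => let: And4 _ _ h _ := AvP b h in h).
  by move: cU cAv; clear; lia.
have [NU [mU dU rU]] := matching_exists (eq_leq (esym cI)).
have {rU} rU : ran NU = I by apply/eqP; rewrite eqEcard rU card_ran // -card_dom // dU cI leqnn.
pose Cs := \bigcup_(b in I) nbh e2 b.
have cC : #|Cs| <= 154.
  apply: leq_trans (card_bigcup_le _ _) _; apply: (@leq_trans (\sum_(b in I) 11)).
    by apply: leq_sum => b bI; have [] := AvP b (subsetP sIA _ bI).
  by rewrite sum_nat_const cI; move: cU; clear; lia.
have [N [mN dN rN]] := matching_exists (leq_trans cC cpend).
have IP b : b \in I -> [/\ b \notin nbh e2 y, b != y & [disjoint nbh e2 b & nbh e2 y]].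
  by move=> bI; have [] := AvP b (subsetP sIA _ bI).
have CP c : c \in Cs -> exists2 b, b \in I & e2 b c.
  by case/bigcupP=> b bI; rewrite inE; exists b.
have UP u : u \in U -> exists2 w, w \in dom W & e1 w u.
  by case/bigcupP=> w wW; rewrite inE; exists w.
have farP w : w \in dom W -> w != x /\ ~~ e1 x w.
  by case/Wfar; rewrite !inE negb_or => /andP[].
have pendP l : l \in ran N -> e1 x l /\ nbh e1 l = [set x].
  move/(subsetP rN); rewrite inE => /andP[exl lL]; split=> //.
  by apply: leaf_nbh lL _; rewrite sym1.
have pendE l v : l \in ran N -> e1 l v = (v == x).
  by move=> /pendP[_ lE]; rewrite -(in_nbh e1 l) lE inE.
have lx l : l \in ran N -> l != x by move=> /pendP[exl _]; apply: contraTneq exl => ->; rewrite irr1.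
have xU u : u \in U -> u != x.
  by case/UP=> w /farP[_ exw] ewu; apply: contraNneq exw => <-; rewrite sym1.
have WU u : u \in U -> u \notin dom W.
  by case/UP=> w wW ewu; apply: contraL ewu => uW; apply: Wind.
have Wl l : l \in ran N -> l \notin dom W.
  by move=> /pendP[exl _]; apply: contraTN exl => /farP[].
have Ul l : l \in ran N -> l \notin U.
  move=> lN; apply/negP => /UP[w /farP[wx _]]; rewrite sym1 pendE //.
  by rewrite (negPf wx).
have yy : y \notin nbh e2 y by rewrite inE irr2.
have Cy c : c \in Cs -> c != y.
  case/CP=> b /IP[bZ _ _] ebc; apply: contraNneq bZ => <-; by rewrite inE sym2.
have CZ c : c \in Cs -> c \notin nbh e2 y.
  case/CP=> b /IP[_ _]; rewrite disjoints_subset => /subsetP s ebc.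
  by have := s c; rewrite !inE ebc => /(_ isT).
have CI c : c \in Cs -> c \notin I.
  by case/CP=> b bI ebc; apply: contraL ebc => cI'; apply: indI.
pose M := [set (x, y)] :|: W :|: NU :|: swap_pairs N.
have dM : dom M = x |: dom W :|: U :|: ran N by rewrite !domU dom1 dom_swap dU.
have rM : ran M = y |: nbh e2 y :|: I :|: Cs by rewrite !ranU ran1 ran_swap dN rW rU.
have mM : matching M.
  apply: matchingU; last 2 first.
  - rewrite dom_swap disjoint_sym disjoints_subset; apply/subsetP=> l lN.
    by rewrite !domU dom1 dU !inE !negb_or lx //= Wl //= Ul.
  - rewrite ran_swap dN disjoint_sym disjoints_subset; apply/subsetP=> c cC'.
    rewrite !ranU ran1 rW rU 2!inE !negb_or [c \in _ :|: nbh e2 y]inE negb_or.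
    by rewrite inE Cy //= CZ //= CI.
  - apply: matchingU => //.
    + apply: matchingU => //; first exact: matching1.
        by rewrite dom1 disjoints1; apply/negP=> /farP[]; rewrite eqxx.
      by rewrite ran1 disjoints1 rW.
    + rewrite domU dom1 dU disjoint_sym disjoints_subset; apply/subsetP=> u uU.
      by rewrite !inE negb_or xU //= WU.
    + rewrite ranU ran1 rW rU disjoint_sym disjoints_subset; apply/subsetP=> b /IP[bZ by' _].
      by rewrite 2!inE negb_or inE by' /=.
  - exact: swap_matching.
(* [171 = 1 + 2 + 14 + 154]. Hence [513 = 3 * 171] and [173 = 171 + 2] in the hypotheses. *)
have cM : #|M| <= 171.
  rewrite -(card_dom mM) dM; have := card_setU_le (x |: dom W :|: U) (ran N).
  have := card_setU_le (x |: dom W) U; have := card_setU_le [set x] (dom W).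
  rewrite cards1 (card_ran mN) -(card_dom mN) dN.
  by move: cW cU cC; clear; lia.
have inW w z : (w, z) \in W -> w \in dom W /\ z \in nbh e2 y.
  by move=> Wwz; rewrite -rW; split; [apply/domP; exists z|apply/ranP; exists w].
have inNU u b : (u, b) \in NU -> u \in U /\ b \in I.
  by move=> Nub; rewrite -rU -dU; split; [apply/domP; exists b|apply/ranP; exists u].
have inN l c : (c, l) \in N -> l \in ran N /\ c \in Cs.
  by move=> Nlc; rewrite -dN; split; [apply/ranP; exists c|apply/domP; exists l].
have Zsub : nbh e2 y \subset ran M by rewrite rM -!setUA setUCA subsetUl.
have Usub : U \subset dom M by rewrite dM -setUA setUCA subsetUl.
have Csub : Cs \subset ran M by rewrite rM subsetUr.
apply: (@clean_reduction n _ _ _ _ M x D) => //.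
- have cross1 p q : p \in [set (x, y)] -> q \in W -> e1 p.1 q.1 -> ~~ e2 p.2 q.2.
    move=> /set1P->; case: q => w z /inW[/farP[_ /negPf/= -> //]].
  have cross2 p q : p \in [set (x, y)] :|: W -> q \in NU -> e1 p.1 q.1 -> ~~ e2 p.2 q.2.
    case: q => u b /setUP[/set1P->|pW] /inNU[_ /IP[bZ _]]; first by rewrite inE in bZ.
    case: p pW => w z /inW[_ zZ]; rewrite disjoints_subset => /subsetP dj _ /=.
    by apply: contraL zZ => ezb; have := dj z; rewrite !inE sym2 => /(_ ezb).
  have cross3 p q : p \in [set (x, y)] :|: W :|: NU -> q \in swap_pairs N ->
      e1 p.1 q.1 -> ~~ e2 p.2 q.2.
    case: p q => a b [l c] pM; rewrite in_swap /= => /inN[lN cC'].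
    rewrite sym1 pendE // => /eqP ax; move: pM; rewrite ax => /setUP[/setUP[/set1P[->]|]|].
    + by have := CZ c cC'; rewrite inE.
    + by case/inW=> /farP[]; rewrite eqxx.
    + by case/inNU=> /xU; rewrite eqxx.
  apply: compatU => //; first apply: compatU => //; first apply: compatU => //.
  + by move=> p q /set1P-> /set1P->; rewrite irr1.
  + by move=> [w z] [w' z'] /inW[wW _] /inW[w'W _] /=; rewrite (negPf (Wind _ _ wW w'W)).
  + by move=> [u b] [u' b'] /inNU[_ bI] /inNU[_ b'I] _; apply: indI.
  + move=> [l c] [l' c']; rewrite !in_swap /= => /inN[lN _] /inN[l'N _].
    by rewrite pendE // (negPf (lx _ l'N)).
- by rewrite dM !inE eqxx.
- by apply: leq_trans D513; apply: (leq_mul (leqnn 3) cM).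
- move=> a b /setUP[/setUP[/setUP[/set1P[-> ->]|/inW[aW _]]|/inNU[_ bI]]|].
  + by right.
  + by left; apply: subset_trans Usub; apply: (bigcup_sup a).
  + by right; apply: subset_trans Csub; apply: (bigcup_sup b).
  + rewrite in_swap => /inN[/pendP[_ ->] _]; left.
    by rewrite sub1set dM !inE eqxx.
- move=> v vM; have vx : v != x by apply: contraNneq vM => ->; rewrite dM !inE eqxx.
  have : #|nbh e1 v :\: dom M| <= #|nbh e1 v :\ x|.
    by apply/subset_leq_card/setDS; rewrite sub1set dM !inE eqxx.
  move=> le_v; apply: leq_trans (deg1 v vx); rewrite -addnA leq_add //.
- move=> v _; apply: leq_trans (deg2 v); rewrite -addnA leq_add //.
    exact: subset_leq_card (subsetDl _ _).
Qed.

(** Since [G2] uses up about [2 * n] of the degree sum, [degsum e1] is at most about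
    [4 * n - 2 * D], and [degsum_pendant] yields far more leaves at [x] than needed. *)
Lemma dominating_dense y (W : {set T1 * T2}) :
  2 * n <= degsum e2 + 16 ->
  matching W -> ran W = nbh e2 y -> #|nbh e2 y| <= 2 ->
  (forall w, w \in dom W -> w \in far /\ #|nbh e1 w| <= 7) ->
  (forall w w', w \in dom W -> w' \in dom W -> ~~ e1 w w') ->
  168 <= #|[set b | [&& b \notin nbh e2 y, b != y, #|nbh e2 b| <= 11
     & [disjoint nbh e2 b & nbh e2 y]]]| -> packable e1 e2.
Proof.
have := bnd; rewrite C_constE => bnd' s2 mW rW cy Wfar Wind cAv.
have nbig : 11 * (195 * 195) <= 3 * n by move: bnd'; clear; lia.
apply: (@dominating_core y W _ mW rW cy Wfar Wind _ cAv).
- by move=> b; rewrite inE => /and4P[].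
- have := degsum_pendant irr1 sym1 x; rewrite dx.
  by move: bnd' s2 big nbig; clear; lia.
- by move: big nbig; clear; lia.
- move=> v /rest_degree1; move: bnd' s2 big nbig leDn; clear; lia.
- move=> v; have := D2 v; have := degree_le_degsum v irr2 sym2.
  have := degree_le_degsum x irr1 sym1; rewrite dx.
  by move: bnd' nbig leDn; clear; lia.
Qed.

(** Here [W] is one pair, covering the only neighbour [z] of [y]. The neighbours of [w] will go to
    non-neighbours of [z] of degree at most 11; even if [z] has degree [D], the constant leaves
    enough of them. *)
Lemma dominating_dense_leaf y z : leaf e2 y -> e2 y z ->
  2 * n <= degsum e2 + 16 -> packable e1 e2.
Proof.
have := bnd; rewrite C_constE => bnd' yL eyz s2.
have nbig : 11 * (195 * 195) <= 3 * n by move: bnd'; clear; lia.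
have nbhy := leaf_nbh yL eyz.
have Far1 := sum_far_degrees irr1 sym1 x; rewrite dx in Far1.
have Far2 := sum_far_degrees irr2 sym2 z.
(* The average degree over [far] is below 8. *)
have [w /andP[wfar w7]] : exists w, (w \in far) && (#|nbh e1 w| <= 7).
  apply/existsP; apply: contraTT isT => /existsPn no_w.
  have : 8 * #|far| <= \sum_(v in far) #|nbh e1 v|.
    rewrite mulnC -sum_nat_const; apply: leq_sum => v vfar.
    by have := no_w v; rewrite vfar -ltnNge.
  rewrite card_far; move: Far1; rewrite -/far; move: (\sum_(v in far) _) => F.
  by move: bnd' s2 leDn nbig; clear; lia.
apply: (@dominating_dense y [set (w, z)]) => //.
- exact: matching1.
- by rewrite ran1 nbhy.
- by rewrite nbhy cards1.
- by move=> v; rewrite dom1 => /set1P->.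
- by move=> v v'; rewrite dom1 => /set1P-> /set1P->; rewrite irr1.
set far2 := ~: (z |: nbh e2 z) in Far2.
have cfar2 : #|far2| + #|nbh e2 z| + 1 = n.
  by rewrite -cT2 -(cardsC (z |: nbh e2 z)) cardsU1 inE irr2 /far2; lia.
pose High := [set v in far2 | 12 <= #|nbh e2 v|].
have high : #|High| * 12 <= \sum_(v in far2) #|nbh e2 v| by apply: markov_card.
have split2 : #|far2| <= #|High| +
    #|[set b | [&& b \notin nbh e2 y, b != y, #|nbh e2 b| <= 11 & [disjoint nbh e2 b & nbh e2 y]]]|.
  apply: leq_trans (card_setU_le _ _); apply/subset_leq_card/subsetP=> v vfar.
  apply/setUP; have [d12|d11] := leqP 12 #|nbh e2 v|; [left|right].
    by rewrite inE vfar.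
  move: vfar; rewrite nbhy !inE negb_or => /andP[vz ezv].
  rewrite vz -ltnS d11 /=; apply/andP; split; first by apply: contraNneq ezv => ->; rewrite sym2.
  by rewrite disjoint_sym disjoints1 inE sym2.
move: split2 high Far2; set Avn := #|[set b | _]|.
move: (\sum_(v in far2) _) #|High| => F H.
have := D2 z; have := degree_le_degsum x irr1 sym1; rewrite dx.
by move: cfar2 bnd' nbig leDn; clear; lia.
Qed.

(** Some vertex [y] has degree exactly 2, as otherwise [degsum e2] would reach [3 * n]; its two
    neighbours are covered by two non-adjacent vertices of [far]. *)
Lemma dominating_dense_no_leaf :
  (forall v, 2 <= #|nbh e2 v|) -> packable e1 e2.
Proof.
have := bnd; rewrite C_constE => bnd' deg2.
have nbig : 11 * (195 * 195) <= 3 * n by move: bnd'; clear; lia.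
have Far1 := sum_far_degrees irr1 sym1 x; rewrite dx -/far in Far1.
have s2 : 2 * n <= degsum e2.
  by rewrite -cT2 mulnC -sum_nat_const -[X in _ <= X]sum_setT_degsum big_mkcond [X in _ <= X]big_mkcond; apply: leq_sum => v _; rewrite inE.
have [y y2] : exists y, #|nbh e2 y| == 2.
  apply/existsP; apply: contraTT isT => /existsPn no_y.
  have : 3 * n <= degsum e2.
    rewrite -cT2 mulnC -sum_nat_const; apply: leq_sum => v _.
    by have := deg2 v; have := no_y v; lia.
  have := degree_le_degsum x irr1 sym1; rewrite dx.
  by move: bnd' big nbig; clear; lia.
(* All other degrees are at least 2, so one degree is at most the excess of [degsum e2] over
   [2 * n], plus 2. *)
have degz z : #|nbh e2 z| + 2 * n <= degsum e2 + 2.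
  rewrite /degsum (bigD1 z) //= -addnA leq_add2l -cT2 addnC.
  have -> : #|T2| = (\sum_(v | v != z) 1).+1.
    by rewrite -sum1_card (bigD1 z) //= add1n.
  rewrite mulnS leq_add2l big_distrr /=; apply: leq_sum => v _; exact: deg2.
have s2u : degsum e2 + 4 * D + 2 * C_const <= 6 * n.
  have := degree_le_degsum x irr1 sym1; rewrite dx C_constE.
  by move: bnd'; clear; lia.
rewrite C_constE in s2u.
pose Low := [set w in far | #|nbh e1 w| <= 7].
pose High := [set w in far | 8 <= #|nbh e1 w|].
have cHL : #|far| <= #|High| + #|Low|.
  apply: leq_trans (card_setU_le _ _); apply/subset_leq_card/subsetP=> v vfar.
  by apply/setUP; have [d8|d7] := leqP 8 #|nbh e1 v|; [left|right]; rewrite inE vfar.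
have cH : #|High| * 8 <= \sum_(v in far) #|nbh e1 v| by apply: markov_card.
have [||I [sIL cI indI]] := @independent_subset _ e1 irr1 sym1 Low 2 7.
- by move=> v; rewrite inE => /andP[].
- move: cHL cH Far1; rewrite card_far; move: (\sum_(v in far) _) #|High| #|Low| => F H L.
  by move: bnd' s2 big leDn nbig; clear; lia.
have [W [mW dW rW]] := matching_exists (eq_leq (etrans cI (esym (eqP y2)))).
have {rW} rW : ran W = nbh e2 y.
  by apply/eqP; rewrite eqEcard rW card_ran // -card_dom // dW cI (eqP y2).
apply: (dominating_dense _ mW rW); rewrite ?(eqP y2) //.
- by move: s2; clear; lia.
- by move=> w; rewrite dW => /(subsetP sIL); rewrite inE => /andP[].
- by move=> w w'; rewrite dW; apply: indI.
(* A vertex of degree at most 11 that is at distance more than 2 from [y] is available. *)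
pose Cov := y |: nbh e2 y :|: \bigcup_(z in nbh e2 y) nbh e2 z.
pose High2 := [set v in [set: T2] | 12 <= #|nbh e2 v|].
have cH2 : #|High2| * 12 <= degsum e2 by rewrite -sum_setT_degsum; apply: markov_card.
have cCov : #|Cov| + 4 * n <= 2 * degsum e2 + 7.
  have := card_setU_le (y |: nbh e2 y) (\bigcup_(z in nbh e2 y) nbh e2 z).
  rewrite cardsU1 (eqP y2) -/Cov; have := leq_b1 (y \notin nbh e2 y).
  have : #|\bigcup_(z in nbh e2 y) nbh e2 z| + 2 * (2 * n) <= 2 * (degsum e2 + 2).
    have := card_bigcup_le (nbh e2 y) (nbh e2).
    have : \sum_(z in nbh e2 y) (#|nbh e2 z| + 2 * n) <= \sum_(z in nbh e2 y) (degsum e2 + 2).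
      by apply: leq_sum => z _; apply: degz.
    by rewrite big_split /= !sum_nat_const (eqP y2); clear; lia.
  by clear; lia.
set Av := [set b | _].
have cAll : n <= #|Cov| + #|High2| + #|Av|.
  rewrite -cT2 -cardsT; have := card_setU_le (Cov :|: High2) Av.
  have := card_setU_le Cov High2.
  have : #|[set: T2]| <= #|Cov :|: High2 :|: Av|.
    apply/subset_leq_card/subsetP=> b _; rewrite in_setU; apply/orP.
    have [bCH|bCH] := boolP (b \in Cov :|: High2); [by left|right].
    move: bCH; rewrite in_setU negb_or => /andP[bC bH].
    move: bC bH; rewrite /Cov !in_setU !negb_or in_set1 => /andP[/andP[by' bZ] bU].
    rewrite /High2 /Av !inE /= -ltnNge ltnS by' => ->.
    move: bZ; rewrite inE => -> /=; rewrite disjoints_subset; apply/subsetP=> v.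
    rewrite !inE => ebv; apply: contra bU => eyv; apply/bigcupP; exists v; rewrite ?inE //.
    by rewrite sym2.
  by clear; lia.
move: cAll cCov cH2; move: #|Cov| #|High2| #|Av| => a b c.
by move: s2u s2 big nbig; clear; lia.
Qed.

Lemma dominating : packable e1 e2.
Proof.
have := bnd; rewrite C_constE => bnd'.
have nbig : 11 * (195 * 195) <= 3 * n by move: bnd'; clear; lia.
have [y /eqP y0|deg1] := pickP (fun y => #|nbh e2 y| == 0).
  apply: (@dominating_isolated y); last exact: cards0_eq.
  by move: big nbig; clear; lia.
have {}deg1 v : 0 < #|nbh e2 v| by rewrite lt0n deg1.
have [[y0 z0] yz0|no_leaf] := pickP (fun p : T2 * T2 => leaf e2 p.1 && e2 p.1 p.2); last first.
  apply: dominating_dense_no_leaf => v; rewrite ltn_neqAle deg1 andbT eq_sym.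
  apply/negP => vL; have := deg1 v; rewrite card_gt0 => /set0Pn[z]; rewrite inE => evz.
  by have := no_leaf (v, z); rewrite /= evz andbT /leaf vL.
(* The leaf is chosen with a neighbour of least degree, so that this degree bounds below the degrees
   of all neighbours of leaves. *)
case: (arg_minnP (P := fun p : T2 * T2 => leaf e2 p.1 && e2 p.1 p.2) (fun p => #|nbh e2 p.2|) yz0).
case=> y z /= /andP[yL eyz] minq.
have supp u v : leaf e2 u -> e2 u v -> #|nbh e2 z| <= #|nbh e2 v|.
  by move=> uL euv; apply: (minq (u, v)); rewrite /= uL.
have [s2|s2] := leqP (degsum e2 + 6) (2 * n); last first.
  by apply: (dominating_dense_leaf yL eyz); move: s2; clear; lia.
have [q4|q4] := leqP (4 * #|nbh e2 z|) n.
  exact: (dominating_leaf yL eyz).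
apply: (dominating_dense_leaf yL eyz).
have [|p pq np] := degsum_big_support sym2 _ deg1 supp; first by move: q4 nbig; clear; lia.
rewrite cT2 in np.
(* Nine vertices of degree above [n / 4] would need more than the [2.2 * n] left for [degsum e2].
   Hence [degsum e2] is at least [2 * n - 16]. *)
have p8 : p <= 8.
  rewrite leqNgt; apply/negP => p9; have : 9 * #|nbh e2 z| <= degsum e2.
    by apply: leq_trans pq; rewrite leq_mul2r p9 orbT.
  have := degree_le_degsum x irr1 sym1; rewrite dx.
  by move: q4 bnd' big; clear; lia.
by move: np p8; clear; lia.
Qed.

End Dominating.

(** * Placing the vertices of large degree *)

Definition cover_nbh (T : finType) (e : rel T) (B : {set T}) : {set T} :=
  \bigcup_(b in B) nbh e b.

Lemma cover_nbh0 (T : finType) (e : rel T) : cover_nbh e set0 = set0.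
Proof. exact: big_set0. Qed.

Definition weight (T : finType) (e : rel T) (X : {set T}) (x : T) : nat := #|nbh e x :\: X|.

(* A bound for the number of vertices outside [X] that may no longer be sent to [b], as they are adjacent to an [x] with [y x] adjacent to [b]. *)
Definition load (T1 T2 : finType) (e1 : rel T1) (e2 : rel T2) (X X' : {set T1})
    (y : T1 -> T2) (b : T2) : nat :=
  \sum_(x in X' | e2 (y x) b) weight e1 X x.

(** Only edges leaving [X] are counted, and each has one end on either side. *)
Lemma sum_weight (T : finType) (e : rel T) (X : {set T}) : symmetric e ->
  2 * \sum_(x in X) weight e X x <= degsum e.
Proof.
move=> sym; rewrite mul2n -addnn.
have E : \sum_(x in X) weight e X x = \sum_(v in ~: X) #|nbh e v :&: X|.
  by rewrite -exchange_nbh //; apply: eq_bigr => x _; rewrite /weight setDE.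
rewrite {2}E /degsum [X in _ <= X](bigID (mem X)) /=; apply: leq_add.
  by apply: leq_sum => x _; apply: subset_leq_card (subsetDl _ _).
rewrite (eq_bigl (fun v => v \notin X)); last by move=> v; rewrite inE.
by apply: leq_sum => x _; apply: subset_leq_card (subsetIl _ _).
Qed.

Section HubPlacement.

Variables (T1 T2 : finType) (e1 : rel T1) (e2 : rel T2).
Hypotheses (irr1 : irreflexive e1) (sym1 : symmetric e1).
Hypothesis sym2 : symmetric e2.
Variables (X : {set T1}) (P : T1 -> {set T2}) (M1 M2 : {set T2}) (kappa kappa1 kappa2 cap : nat).

(** A load above [cap] is tolerated at a monitored vertex touched by a single placed vertex: it is
    then no more than one degree. *)
Record placed (X' : {set T1}) (y : T1 -> T2) : Prop := Placed {
  placed_inj : {in X' &, injective y};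
  placed_pool : forall x, x \in X' -> y x \in P x;
  placed_compat : forall x x', x \in X' -> x' \in X' -> e1 x x' -> ~~ e2 (y x) (y x');
  placed_load : forall b, b \in M1 :|: M2 ->
    load e1 e2 X X' y b <= cap \/ #|[set x in X' | e2 (y x) b]| <= 1 }.

Lemma sum_load (M : {set T2}) k (X' : {set T1}) (y : T1 -> T2) : X' \subset X ->
  (forall x, x \in X' -> #|nbh e2 (y x) :&: M| <= k) ->
  2 * \sum_(b in M) load e1 e2 X X' y b <= k * degsum e1.
Proof.
move=> sX' kP; rewrite /load.
under eq_bigr do rewrite big_mkcondr /=.
rewrite exchange_big /=; apply: leq_trans (leq_mul (leqnn k) (sum_weight X sym1)).
rewrite mulnCA leq_mul2l /= big_distrr /= [X in _ <= X](bigID (mem X')) /=.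
apply: leq_trans (leq_addr _ _).
rewrite [X in _ <= X](eq_bigl (fun x => x \in X')); last first.
  by move=> x; rewrite andb_idl // => /(subsetP sX').
apply: leq_sum => x xX'; rewrite -big_mkcondr /= sum_nat_const.
rewrite leq_mul2r; apply/orP; right; apply: leq_trans (kP x xX').
by apply/subset_leq_card/subsetP=> b; rewrite !inE andbC.
Qed.

Hypothesis poolP : forall x v, x \in X -> v \in P x ->
  [/\ #|nbh e2 v| <= kappa, #|nbh e2 v :&: M1| <= kappa1 & #|nbh e2 v :&: M2| <= kappa2].

Hypothesis free : forall x (B1 B2 : {set T2}) (j : nat), x \in X -> B1 \subset M1 -> B2 \subset M2 ->
  j * j <= degsum e1 ->
  #|B1| * (cap - #|X|) <= kappa1 * degsum e1 -> #|B2| * (cap - #|X|) <= kappa2 * degsum e1 ->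
  #|X| + kappa * j < #|P x :\: (cover_nbh e2 B1 :|: cover_nbh e2 B2)|.

Lemma place_one (X' : {set T1}) (y : T1 -> T2) (x : T1) : X' \subset X ->
  placed X' y -> x \in X -> x \notin X' ->
  (forall x', x' \in X' -> #|nbh e1 x| <= #|nbh e1 x'|) ->
  exists y', placed (x |: X') y'.
Proof.
move=> sX' [injy py cy ly] xX xX' maxX'.
pose sat b := [exists x' in X', e2 (y x') b] && (cap < load e1 e2 X X' y b + weight e1 X x).
(* A placed [x'] touching [b] has degree at least that of [x], so up to [#|X|] the weight of [x] is
   at most the load already present. *)
have sat_load b : sat b -> cap - #|X| <= 2 * load e1 e2 X X' y b.
  case/andP=> /exists_inP[x' x'X' ex'b] gt_cap.
  have w' : weight e1 X x <= #|nbh e1 x| by apply: subset_leq_card (subsetDl _ _).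
  have w'' : #|nbh e1 x'| <= weight e1 X x' + #|X|.
    rewrite /weight -(cardsID X (nbh e1 x')) addnC leq_add2l.
    by apply: subset_leq_card (subsetIr _ _).
  have w3 : weight e1 X x' <= load e1 e2 X X' y b.
    by rewrite /load (bigD1 x') /= ?x'X' // leq_addr.
  by move: (maxX' x' x'X') w' w'' w3 gt_cap; clear; lia.
have card_sat (M : {set T2}) k : (forall v, v \in X' -> #|nbh e2 (y v) :&: M| <= k) ->
    #|[set b in M | sat b]| * (cap - #|X|) <= k * degsum e1.
  move=> kP; apply: leq_trans (sum_load sX' kP).
  rewrite -sum_nat_const big_distrr /= [X in _ <= X](bigID sat) /=.
  apply: leq_trans (leq_addr _ _).
  rewrite [X in _ <= X](eq_bigl (fun b => b \in [set b in M | sat b])); last first.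
    by move=> b; rewrite inE.
  by apply: leq_sum => b; rewrite inE => /andP[_]; apply: sat_load.
pose J := nbh e1 x :&: X'.
(* Every vertex of [J] has at least the degree of [x], hence degree at least [#|J|]. *)
have cJ : #|J| * #|J| <= degsum e1.
  apply: leq_trans (degsum_sub e1 J); rewrite -sum_nat_const; apply: leq_sum => x'.
  rewrite inE => /andP[_ /maxX']; apply: leq_trans.
  by apply: subset_leq_card (subsetIl _ _).
have Xin x' : x' \in X' -> x' \in X by apply: (subsetP sX').
pose B1 := [set b in M1 | sat b]; pose B2 := [set b in M2 | sat b].
have room : #|X| + kappa * #|J| < #|P x :\: (cover_nbh e2 B1 :|: cover_nbh e2 B2)|.
  apply: free => //; first by apply/subsetP=> b; rewrite inE => /andP[].
  - by apply/subsetP=> b; rewrite inE => /andP[].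
  - by apply: card_sat => v vX'; have [] := poolP (Xin _ vX') (py _ vX').
  - by apply: card_sat => v vX'; have [] := poolP (Xin _ vX') (py _ vX').
pose used := [set y x' | x' in X'] :|: \bigcup_(x' in J) nbh e2 (y x').
have cused : #|used| <= #|X| + kappa * #|J|.
  apply: leq_trans (card_setU_le _ _) (leq_add _ _).
    by apply: leq_trans (leq_imset_card _ _) (subset_leq_card sX').
  apply: leq_trans (card_bigcup_le _ _) _; rewrite mulnC -sum_nat_const.
  apply: leq_sum => x'; rewrite inE => /andP[_ x'X'].
  by have [] := poolP (Xin _ x'X') (py _ x'X').
have /subsetPn[v] : ~~ (P x :\: (cover_nbh e2 B1 :|: cover_nbh e2 B2) \subset used).
  by apply: contraL room => /subset_leq_card le_used; rewrite -leqNgt (leq_trans le_used).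
rewrite !in_setD in_setU negb_or => /andP[/andP[vB1 vB2] vP].
rewrite /used in_setU negb_or => /andP[v_new v_ind].
have not_sat b : b \in M1 :|: M2 -> e2 v b -> ~~ sat b.
  move=> bM evb; apply/negP => satb; case/setUP: bM => bM.
    by case/negP: vB1; apply/bigcupP; exists b; rewrite inE ?bM ?satb // sym2.
  by case/negP: vB2; apply/bigcupP; exists b; rewrite inE ?bM ?satb // sym2.
pose y' a := if a == x then v else y a.
have y'X a : a \in X' -> y' a = y a.
  by move=> aX'; rewrite /y'; case: eqP => // ax; rewrite -ax aX' in xX'.
have y'x : y' x = v by rewrite /y' eqxx.
have ind_v x' : x' \in X' -> e1 x x' -> ~~ e2 (y x') v.
  move=> x'X' exx'; apply: contra v_ind => e2v; apply/bigcupP; exists x'; rewrite !inE ?exx' //.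
have vX' x' : x' \in X' -> y x' <> v.
  by move=> x'X' eq_v; case/imsetP: v_new; exists x'.
exists y'; split.
- move=> a b /setU1P[->|aX'] /setU1P[->|bX'] //; rewrite ?y'x ?y'X //.
  + by move=> /esym/vX'; case.
  + by move=> /vX'; case.
  + exact: injy.
- by move=> a /setU1P[->|aX']; rewrite ?y'x ?y'X //; apply: py.
- move=> a b /setU1P[->|aX'] /setU1P[->|bX']; rewrite ?y'x ?y'X //.
  + by rewrite irr1.
  + by move=> exb; rewrite sym2; apply: ind_v.
  + by rewrite sym1 => exa; apply: ind_v.
  + exact: cy.
move=> b bM.
have loadE : load e1 e2 X (x |: X') y' b = load e1 e2 X X' y b + (if e2 v b then weight e1 X x else 0).
  rewrite /load big_mkcondr big_setU1 //= y'x addnC [in RHS]big_mkcondr; congr (_ + _).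
  by apply: eq_bigr => a aX'; rewrite y'X.
have cardE : [set a in x |: X' | e2 (y' a) b] =
    (if e2 v b then [set x] else set0) :|: [set a in X' | e2 (y a) b].
  apply/setP=> a; rewrite !inE; have [->|ax] /= := eqVneq a x.
    by rewrite y'x (negPf xX'); case: ifP; rewrite !inE ?eqxx.
  rewrite /y' (negPf ax); case: ifP; rewrite !inE ?(negPf ax) //.
rewrite loadE cardE; case: ifP => evb; last by rewrite addn0 set0U; apply: ly.
have := not_sat b bM evb; rewrite negb_and => /orP[no_x|]; last by rewrite -leqNgt; left.
right; have -> : [set a in X' | e2 (y a) b] = set0.
  apply/setP=> a; rewrite !inE; apply/negP => /andP[aX' eab].
  by case/negP: no_x; apply/exists_inP; exists a.
by rewrite setU0 cards1.
Qed.

(* Vertices of [X] are placed in order of decreasing degree, avoiding the neighbours of monitored vertices that are already heavily loaded. *)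
Lemma place_hubs (y0 : T1 -> T2) : exists y, placed X y.
Proof.
have main k : k <= #|X| -> exists (X' : {set T1}) (y : T1 -> T2), [/\ X' \subset X, #|X'| = k, placed X' y &
    forall x x', x \in X :\: X' -> x' \in X' -> #|nbh e1 x| <= #|nbh e1 x'|].
  elim: k => [|k IHk] lek.
    exists set0, y0; split; rewrite ?sub0set ?cards0 //; last by move=> x x' _; rewrite inE.
    split=> [a b|a|a b|b _]; rewrite ?inE //.
    by left; rewrite /load big_mkcondr big_set0.
  have [X' [y [sX' cX' plX' maxX']]] := IHk (ltnW lek).
  have [x0 x0X] : exists x0, x0 \in X :\: X'.
    by apply/set0Pn; rewrite -card_gt0 cardsD (setIidPr sX') cX' subn_gt0.
  case: (arg_maxnP (P := fun x => x \in X :\: X') (fun x => #|nbh e1 x|) x0X) => x xX maxx.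
  have [xX' xX2] : x \notin X' /\ x \in X by move: xX; rewrite inE => /andP[].
  have [y' ply'] := place_one sX' plX' xX2 xX' (fun x' => maxX' x x' xX).
  exists (x |: X'), y'; split=> //.
  - by rewrite subUset sub1set xX2.
  - by rewrite cardsU1 xX' cX'.
  - move=> a b; rewrite !inE negb_or => /andP[/andP[ax aX'] aX] /orP[/eqP->|bX'].
      by apply: maxx; rewrite inE aX'.
    by apply: maxX' => //; rewrite inE aX'.
have [X' [y [sX' cX' plX' _]]] := main _ (leqnn _).
have eqX : X' = X by apply/eqP; rewrite eqEcard sX' cX' leqnn.
by exists y; move: plX'; rewrite eqX.
Qed.

End HubPlacement.

(* A bound for the number of positions outside [ran M] that [M] forbids to [u]. *)
Definition forbidden (T1 T2 : finType) (e1 : rel T1) (e2 : rel T2) (M : {set T1 * T2}) (u : T1) : nat :=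
  \sum_(p in M | e1 u p.1) #|nbh e2 p.2 :\: ran M|.

Lemma swap_subset (T1 T2 : finType) (K L : {set T1 * T2}) :
  K \subset L -> swap_pairs K \subset swap_pairs L.
Proof. by move=> sKL; apply/subsetP=> -[b a]; rewrite !in_swap; apply: (subsetP sKL). Qed.

Lemma card_swap (T1 T2 : finType) (K : {set T1 * T2}) : matching K -> #|swap_pairs K| = #|K|.
Proof. by move=> mK; rewrite -(card_dom (swap_matching mK)) dom_swap card_ran. Qed.

(** * Placing the exceptional vertices and finishing by swaps *)

Section ExtendMatching.

Variables (T1 T2 : finType) (e1 : rel T1) (e2 : rel T2).
Hypotheses (irr1 : irreflexive e1) (sym1 : symmetric e1).
Hypothesis sym2 : symmetric e2.
Variables (M0 : {set T1 * T2}) (t c : nat).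
Hypotheses (mM0 : matching M0) (cM0 : compat e1 e2 M0).
Hypothesis small2 : forall b, b \notin ran M0 -> #|nbh e2 b| <= t.

(** Greedy: each newly used position has degree at most [t], so all the earlier choices exclude at
    most [c + t * c] further positions. *)
Lemma extend_matching (U : {set T1}) : #|U| <= c -> [disjoint U & dom M0] ->
  (forall u, u \in U -> forbidden e1 e2 M0 u + #|M0| + c + t * c <= #|T2|) ->
  exists M, [/\ matching M, compat e1 e2 M, M0 \subset M, dom M = dom M0 :|: U &
    (forall p, p \in M -> p \in M0 \/ p.1 \in U /\ p.2 \notin ran M0)].
Proof.
elim: {U}#|U| {-2}U (erefl #|U|) => [|k IHk] U cU leUc dU room.
  exists M0; split=> //; first by rewrite (cards0_eq cU) setU0.
  by move=> p; left.
have [u uU] : exists u, u \in U by apply/set0Pn; rewrite -card_gt0 cU.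
have cU' : #|U :\ u| = k by move: cU; rewrite (cardsD1 u) uU => -[].
have [|||M [mM cM sM dM newM]] := IHk (U :\ u) cU'.
- by apply: leq_trans leUc; rewrite cU cU'.
- by apply: disjointWl dU; apply: subsetDl.
- by move=> v /setD1P[_ vU]; apply: room.
have uM : u \notin dom M.
  rewrite dM !inE eqxx /= orbF; move: dU; rewrite disjoints_subset => /subsetP /(_ u uU).
  by rewrite inE.
pose new := M :\: M0.
have cMk : #|M| = #|M0| + k.
  rewrite -(card_dom mM) dM cardsU (card_dom mM0) cU'.
  have -> : dom M0 :&: (U :\ u) = set0; last by rewrite cards0 subn0.
  apply/eqP; rewrite setI_eq0 disjoint_sym; apply: disjointWl dU; exact: subsetDl.
have cnew : #|new| = k by rewrite cardsD (setIidPr sM) cMk addKn.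
pose bad := ran M :|: (\bigcup_(p in M0 | e1 u p.1) (nbh e2 p.2 :\: ran M0))
   :|: \bigcup_(p in new) nbh e2 p.2.
have lt_bad : #|bad| < #|T2|.
  apply: leq_trans (room u uU).
  have le1 : #|\bigcup_(p in M0 | e1 u p.1) (nbh e2 p.2 :\: ran M0)| <= forbidden e1 e2 M0 u.
    rewrite /forbidden; elim/big_rec2: _ => [|p m B _ le_Bm]; first by rewrite cards0.
    by apply: leq_trans (card_setU_le _ _) _; rewrite leq_add2l.
  have le2 : #|\bigcup_(p in new) nbh e2 p.2| <= t * k.
    apply: leq_trans (card_bigcup_le _ _) _; rewrite -cnew mulnC -sum_nat_const.
    apply: leq_sum => p /setDP[/newM[->//|[_ pM0]] _]; exact: small2.
  have := card_setU_le (ran M :|: (\bigcup_(p in M0 | e1 u p.1) (nbh e2 p.2 :\: ran M0)))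
     (\bigcup_(p in new) nbh e2 p.2).
  have := card_setU_le (ran M) (\bigcup_(p in M0 | e1 u p.1) (nbh e2 p.2 :\: ran M0)).
  rewrite (card_ran mM) cMk -/bad.
  have : t * k <= t * c by rewrite leq_mul2l -ltnS -cU ltnW ?orbT // ltnS.
  move: le1 le2 leUc; rewrite cU.
  move: #|\bigcup_(p in M0 | _) _| #|\bigcup_(p in new) _| #|_ :|: _| => a1 a2 a3.
  by move: (forbidden _ _ _ _) (t * k) (t * c) #|M0| #|bad|; clear; lia.
have /subsetPn[v _ vbad] : ~~ ([set: T2] \subset bad).
  by apply: contraL lt_bad => /subset_leq_card; rewrite cardsT -leqNgt.
move: vbad; rewrite /bad in_setU negb_or in_setU negb_or => /andP[/andP[vM v1] v2].
have ranM0 : ran M0 \subset ran M by apply: imsetS.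
exists (M :|: [set (u, v)]); split.
- apply: matchingU => //; first exact: matching1.
    by rewrite dom1 disjoint_sym disjoints1.
  by rewrite ran1 disjoint_sym disjoints1.
- apply: compatU => //; first by move=> p q /set1P-> /set1P->; rewrite irr1.
  move=> p q pM /set1P-> /=; rewrite sym1 => eup; apply/negP => epv.
  have [pM0|pM0] := boolP (p \in M0).
    case/negP: v1; apply/bigcupP; exists p; rewrite ?pM0 // !inE epv andbT.
    by apply: contra vM; apply: (subsetP ranM0).
  by case/negP: v2; apply/bigcupP; exists p; rewrite ?inE ?pM0.
- by apply: subset_trans (subsetUl _ _).
- by rewrite domU dom1 dM -setUA (setUC (U :\ u)) setD1K.
- move=> p /setUP[/newM[|[/setD1P[_ pU] pM0]]|/set1P->]; [by left|by right|right].
  by split=> //=; apply: contra vM; apply: (subsetP ranM0).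
Qed.

End ExtendMatching.

Section Reach.

Variables (T1 T2 : finType) (e1 : rel T1) (e2 : rel T2) (M N : {set T1 * T2}) (t : nat).
Hypothesis sMN : M \subset N.

Lemma forbidden_sub u : (forall p, p \in N :\: M -> #|nbh e2 p.2| <= t) ->
  forbidden e1 e2 N u <= forbidden e1 e2 M u + t * #|N :\: M|.
Proof.
move=> small; rewrite /forbidden big_mkcondr (bigID (mem M)) /=; apply: leq_add.
  rewrite [X in _ <= X]big_mkcondr (eq_bigl (fun p => p \in M)); last first.
    by move=> p; rewrite andb_idl // => /(subsetP sMN).
  apply: leq_sum => p pM; case: ifP => // _.
  by apply/subset_leq_card/setDS/imsetS.
rewrite (eq_bigl (fun p => p \in N :\: M)); last by move=> p; rewrite inE andbC.
rewrite mulnC -sum_nat_const; apply: leq_sum => p pNM; case: ifP => // _.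
by apply: leq_trans (small p pNM); apply: subset_leq_card (subsetDl _ _).
Qed.

(** Neighbours of [u] placed by [M] are accounted for by [forbidden]; any other neighbour sits on a
    position of degree at most [t]. *)
Lemma reach_le f u : matching M -> injective f -> extends M f ->
  (forall b, b \notin ran M -> #|nbh e2 b| <= t) ->
  reach e1 e2 N f u <= forbidden e1 e2 M u + t * #|nbh e1 u|.
Proof.
move=> mM injf extf small; rewrite /reach (bigID (mem (dom M))) /=; apply: leq_add.
  rewrite /forbidden [X in _ <= X]big_mkcondr /=.
  have -> : \sum_(p in M) (if e1 u p.1 then #|nbh e2 p.2 :\: ran M| else 0) =
      \sum_(p in M) (if e1 u p.1 then #|nbh e2 (f p.1) :\: ran M| else 0).
    by apply: eq_bigr => p pM; rewrite extf.
  have injp : {in M &, injective (fun p : T1 * T2 => p.1)}.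
    move=> p q pM qM eq1; have := mM p q pM qM; rewrite eq1 eqxx => /esym/eqP eq2.
    by rewrite [p]surjective_pairing [q]surjective_pairing eq1 eq2.
  rewrite -(big_imset (fun a => if e1 u a then #|nbh e2 (f a) :\: ran M| else 0) injp) /=.
  rewrite -big_mkcondr /= (eq_bigl (fun a => (a \in dom M) && e1 u a)); last first.
    by move=> a; rewrite inE andbC.
  by apply: leq_sum => a _; apply/subset_leq_card/setDS/imsetS.
rewrite mulnC -sum_nat_const [X in _ <= X](bigID (mem (dom M))) /=.
apply: leq_trans (leq_addl _ _); apply: leq_sum => a /andP[_ aM].
apply: leq_trans (subset_leq_card (subsetDl _ _)) (small _ _).
apply: contra aM => /ranP[a' a'M]; apply/domP; exists (f a).
by have /= /injf eq_a := extf _ a'M; rewrite -{1}eq_a.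
Qed.

End Reach.

(** The vertices with more than [lambda] forbidden positions are placed first, those of [T1] and
    then, after exchanging the graphs, those of [T2]. Every remaining vertex has reach at most
    [lambda + t * t], and [finish] applies. *)
Lemma complete_matching (T1 T2 : finType) (e1 : rel T1) (e2 : rel T2) (M : {set T1 * T2}) (t c lambda : nat) :
  irreflexive e1 -> symmetric e1 -> irreflexive e2 -> symmetric e2 -> #|T1| = #|T2| ->
  matching M -> compat e1 e2 M ->
  (forall u, u \notin dom M -> #|nbh e1 u| <= t) ->
  (forall b, b \notin ran M -> #|nbh e2 b| <= t) ->
  #|[set u in ~: dom M | lambda < forbidden e1 e2 M u]|
    + #|[set b in ~: ran M | lambda < forbidden e2 e1 (swap_pairs M) b]| <= c ->
  (forall u, u \notin dom M -> forbidden e1 e2 M u + #|M| + c + t * c <= #|T1|) ->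
  (forall b, b \notin ran M -> forbidden e2 e1 (swap_pairs M) b + #|M| + c + t * c <= #|T1|) ->
  #|M| + c + 2 * (lambda + t * t) + 1 < #|T1| ->
  packable e1 e2.
Proof.
move=> irr1 sym1 irr2 sym2 eqT mM cM small1 small2.
set U := [set u in _ | _]; set B := [set b in _ | _] => cUB room1 room2 room.
have cU : #|U| <= c by apply: leq_trans cUB; apply: leq_addr.
have dU : [disjoint U & dom M].
  by rewrite disjoints_subset; apply/subsetP=> u; rewrite 2!inE => /andP[].
have [|N [mN cN sN dN newN]] := extend_matching irr1 sym1 sym2 mM cM small2 cU dU.
  by move=> u; rewrite 2!inE -eqT => /andP[uM _]; apply: room1.
have cNM : #|N| = #|M| + #|U|.
  by rewrite -(card_dom mN) dN -(card_dom mM) cardsU setIC (disjoint_setI0 dU) cards0 subn0.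
have cND : #|N :\: M| = #|U| by rewrite cardsD (setIidPr sN) cNM addKn.
have swapD (K L : {set T1 * T2}) : swap_pairs K :\: swap_pairs L = swap_pairs (K :\: L).
  by apply/setP=> -[b a]; rewrite !inE.
have small1' a : a \notin ran (swap_pairs N) -> #|nbh e1 a| <= t.
  by rewrite ran_swap dN inE negb_or => /andP[aM _]; apply: small1.
pose B' := B :\: ran N.
have cB : #|B'| <= #|B| by apply: subset_leq_card (subsetDl _ _).
have dB : [disjoint B' & dom (swap_pairs N)].
  by rewrite dom_swap disjoints_subset; apply/subsetP=> b /setDP[_]; rewrite inE.
have cNDs : #|swap_pairs N :\: swap_pairs M| = #|U|.
  by rewrite swapD card_swap //; apply: matching_sub mN; apply: subsetDl.
have [|L [mL cL sL dL newL]] := extend_matching irr2 sym2 sym1 (swap_matching mN)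
  (swap_compat cN) small1' cB dB.
  move=> b /setDP[]; rewrite 2!inE => /andP[bM _] _.
  have := room2 b bM; have := @forbidden_sub _ _ e2 e1 _ _ t (swap_subset sN) b.
  rewrite cNDs (card_swap mN) cNM => /(_ _) H.
  have /H : forall p, p \in swap_pairs N :\: swap_pairs M -> #|nbh e1 p.2| <= t.
    move=> [b' a]; rewrite swapD in_swap inE => /andP[abM /newN[|[aU _]]].
      by rewrite (negPf abM).
    by apply: small1; move: aU; rewrite /= 2!inE => /andP[].
  have : t * #|U| + t * #|B| <= t * c by rewrite -mulnDr leq_mul2l cUB orbT.
  move: cUB; move: (forbidden _ _ _ _) (forbidden _ _ _ _) (t * c) (t * #|B|) (t * #|U|) #|M| #|U| #|B|.
  by clear; lia.
pose N' := swap_pairs L.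
have sMN' : M \subset N'.
  by apply: subset_trans sN _; rewrite -[N]swapK; apply: swap_subset.
have mN' : matching N' by apply: swap_matching.
have dN' : dom N' = ran L by rewrite dom_swap.
have rN' : ran N' = ran N :|: B' by rewrite ran_swap dL dom_swap.
have cN' : #|N'| <= #|M| + c.
  rewrite (card_swap mL) -(card_dom mL) dL dom_swap; apply: leq_trans (card_setU_le _ _) _.
  by rewrite (card_ran mN) cNM -addnA leq_add2l (leq_trans _ cUB) // leq_add2l.
have domN' : dom N \subset dom N' by rewrite dN' -(ran_swap N); apply: imsetS.
apply: (@finish _ _ e1 e2 irr1 sym1 irr2 sym2 N' (lambda + t * t) (lambda + t * t) eqT mN').
- by apply: swap_compat.
- move=> f injf extf u uN'.
  have uM : u \notin dom M by apply: contra uN'; apply/subsetP/imsetS.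
  have extM : extends M f by move=> p pM; apply: extf; apply: (subsetP sMN').
  apply: leq_trans (reach_le e1 sMN' u mM injf extM small2) _; apply: leq_add.
    rewrite leqNgt; apply: contra uN' => lt_u; apply: (subsetP domN').
    by rewrite dN inE [u \in U]inE inE uM lt_u orbT.
  by rewrite leq_mul2l small1 ?orbT.
- move=> g injg; rewrite /N' swapK => extg b bN'.
  have sML : swap_pairs M \subset L by rewrite -[L]swapK; apply: swap_subset.
  have bM : b \notin ran M by apply: contra bN'; apply/subsetP/imsetS.
  have extM : extends (swap_pairs M) g by move=> p pM; apply: extg; apply: (subsetP sML).
  have small1'' a : a \notin ran (swap_pairs M) -> #|nbh e1 a| <= t.
    by rewrite ran_swap; apply: small1.
  apply: leq_trans (reach_le e2 sML b (swap_matching mM) injg extM small1'') _; apply: leq_add.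
    rewrite leqNgt; apply: contra bN' => lt_b; rewrite ran_swap dL dom_swap inE.
    have [//|bN] /= := boolP (b \in ran N).
    by rewrite inE bN inE inE bM lt_b.
  by rewrite leq_mul2l small2 ?orbT.
- move: room cN'; move: #|N'| #|M| #|T1| (t * t); clear; lia.
Qed.

(** * Completing a placement of the hubs *)

Definition hubs (T : finType) (e : rel T) (t : nat) : {set T} := [set v | t <= #|nbh e v|].

Section HubCompletion.

Variables (T1 T2 : finType) (e1 : rel T1) (e2 : rel T2) (X : {set T1}) (Z : {set T2}).
Hypothesis sym1 : symmetric e1.
Variables (y : T1 -> T2) (w : T2 -> T1) (kappa t : nat).
Hypotheses (injy : {in X &, injective y}) (injw : {in Z &, injective w}).
Hypotheses (yZ : forall x, x \in X -> y x \notin Z) (wX : forall z, z \in Z -> w z \notin X).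
Hypothesis degy : forall x, x \in X -> #|nbh e2 (y x)| <= kappa.

Definition hub_matching : {set T1 * T2} :=
  [set (x, y x) | x in X] :|: swap_pairs [set (z, w z) | z in Z].

Lemma hub_matching_dom : dom hub_matching = X :|: [set w z | z in Z].
Proof. by rewrite domU dom_graph dom_swap ran_graph. Qed.

Lemma hub_matching_ran : ran hub_matching = [set y x | x in X] :|: Z.
Proof. by rewrite ranU ran_graph ran_swap dom_graph. Qed.

Lemma hub_matchingP : matching hub_matching.
Proof.
apply: matchingU; first exact: graph_matching.
- exact/swap_matching/graph_matching.
- rewrite dom_graph dom_swap ran_graph disjoint_sym disjoints_subset.
  by apply/subsetP=> a /imsetP[z zZ ->]; rewrite inE wX.
- rewrite ran_graph ran_swap dom_graph disjoints_subset.
  by apply/subsetP=> b /imsetP[x xX ->]; rewrite inE yZ.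
Qed.

Lemma card_hub_matching : #|hub_matching| <= #|X| + #|Z|.
Proof.
rewrite -(card_dom hub_matchingP) hub_matching_dom.
by apply: leq_trans (card_setU_le _ _) _; rewrite leq_add2l leq_imset_card.
Qed.

(** The pairs [(w z, z)] contribute the load of [u]; at most [t] pairs [(x, y x)] meet a neighbour
    of [u], each forbidding at most [kappa] positions. *)
Lemma forbidden_hub_matching u : #|nbh e1 u| <= t ->
  forbidden e1 e2 hub_matching u <= load e2 e1 Z Z w u + kappa * t.
Proof.
move=> small; rewrite /forbidden big_mkcond.
pose F (p : T1 * T2) := if e1 u p.1 then #|nbh e2 p.2 :\: ran hub_matching| else 0.
have -> : \sum_p (if (p \in hub_matching) && e1 u p.1 then #|nbh e2 p.2 :\: ran hub_matching| else 0)
    = \sum_(p in hub_matching) F p.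
  by rewrite [RHS]big_mkcond; apply: eq_bigr => p _; case: (p \in _).
have -> : \sum_(p in hub_matching) F p = \sum_(x in X) F (x, y x) + \sum_(z in Z) F (w z, z).
  rewrite /hub_matching; set A := [set _ | _ in X]; set B := swap_pairs _.
  rewrite (eq_bigl (fun p => p \in [predU A & B])); last by move=> p; rewrite !inE.
  rewrite bigU /=; last first.
    rewrite disjoints_subset; apply/subsetP=> -[a b] /imsetP[x xX [-> ->]]; rewrite inE in_swap.
    by apply/negP => /imsetP[z zZ [yz _]]; have := yZ xX; rewrite yz zZ.
  congr (_ + _); first by rewrite big_imset //= => a b _ _ [].
  have -> : B = [set (w z, z) | z in Z].
    apply/setP=> -[a b]; rewrite in_swap; apply/imsetP/imsetP => -[z zZ [-> ->]]; by exists z.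
  by rewrite big_imset //= => a b _ _ [].
rewrite addnC; apply: leq_add.
  rewrite /load [X in _ <= X]big_mkcondr /=; apply: leq_sum => z _; rewrite /F /= sym1.
  case: ifP => // _; apply/subset_leq_card/setDS; rewrite hub_matching_ran; exact: subsetUr.
rewrite /F -big_mkcondr /=; apply: (@leq_trans (\sum_(x in X | e1 u x) kappa)).
  apply: leq_sum => x /andP[xX _]; apply: leq_trans (degy xX).
  exact: subset_leq_card (subsetDl _ _).
rewrite sum_nat_const mulnC leq_mul2l; apply/orP; right; apply: leq_trans small.
by apply/subset_leq_card/subsetP=> v; rewrite !inE => /andP[].
Qed.

End HubCompletion.

Lemma swap_hub_matching (T1 T2 : finType) (X : {set T1}) (Z : {set T2}) (y : T1 -> T2) (w : T2 -> T1) :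
  swap_pairs (hub_matching X Z y w) = hub_matching Z X w y.
Proof. by rewrite /hub_matching swapU swapK setUC. Qed.

Lemma hub_completion (T1 T2 : finType) (e1 : rel T1) (e2 : rel T2) (y : T1 -> T2) (w : T2 -> T1)
    (t c kappa L n : nat) (X := hubs e1 t) (Z := hubs e2 t) :
  irreflexive e1 -> symmetric e1 -> irreflexive e2 -> symmetric e2 ->
  #|T1| = n -> #|T2| = n ->
  {in X &, injective y} -> {in Z &, injective w} ->
  (forall x, x \in X -> y x \notin Z /\ #|nbh e2 (y x)| <= kappa) ->
  (forall z, z \in Z -> w z \notin X /\ #|nbh e1 (w z)| <= kappa) ->
  (forall x x', x \in X -> x' \in X -> e1 x x' -> ~~ e2 (y x) (y x')) ->
  (forall z z', z \in Z -> z' \in Z -> e2 z z' -> ~~ e1 (w z) (w z')) ->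
  (forall x z, x \in X -> z \in Z -> e1 x (w z) -> ~~ e2 (y x) z) ->
  (forall u, u \notin X -> load e2 e1 Z Z w u <= L) ->
  (forall b, b \notin Z -> load e1 e2 X X y b <= L) ->
  #|[set u in ~: X | n < 5 * load e2 e1 Z Z w u]|
    + #|[set b in ~: Z | n < 5 * load e1 e2 X X y b]| <= c ->
  L + kappa * t + #|X| + #|Z| + c + t * c <= n ->
  5 * (#|X| + #|Z| + c + 2 * (kappa * t + t * t) + 1) + 2 * n < 5 * n ->
  packable e1 e2.
Proof.
move=> irr1 sym1 irr2 sym2 cT1 cT2 injy injw yP wP yy ww yw Lw Ly cB room1 room2.
pose M := hub_matching X Z y w.
have yZ x : x \in X -> y x \notin Z by case/yP.
have wX z : z \in Z -> w z \notin X by case/wP.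
have dy x : x \in X -> #|nbh e2 (y x)| <= kappa by case/yP.
have dw z : z \in Z -> #|nbh e1 (w z)| <= kappa by case/wP.
have mM : matching M by apply: hub_matchingP.
have small1 u : u \notin dom M -> u \notin X /\ #|nbh e1 u| <= t.
  rewrite hub_matching_dom inE negb_or => /andP[uX _]; split=> //.
  by move: uX; rewrite inE -ltnNge; apply: ltnW.
have small2 b : b \notin ran M -> b \notin Z /\ #|nbh e2 b| <= t.
  rewrite hub_matching_ran inE negb_or => /andP[_ bZ]; split=> //.
  by move: bZ; rewrite inE -ltnNge; apply: ltnW.
have forb1 u : u \notin dom M -> forbidden e1 e2 M u <= load e2 e1 Z Z w u + kappa * t.
  by case/small1=> _ ut; apply: forbidden_hub_matching.
have forb2 b : b \notin ran M -> forbidden e2 e1 (swap_pairs M) b <= load e1 e2 X X y b + kappa * t.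
  by case/small2=> _ bt; rewrite swap_hub_matching; apply: forbidden_hub_matching.
have cM : #|M| <= #|X| + #|Z| by apply: card_hub_matching.
(* A vertex is exceptional when its load exceeds [n / 5]. With [t * t] at most about [n / 5], the
   two reaches together then take about [4 * n / 5] positions. *)
apply: (@complete_matching _ _ e1 e2 M t c (n %/ 5 + kappa * t)) => //.
- by rewrite cT1 cT2.
- rewrite /M /hub_matching; apply: compatU => //.
  + by move=> p q /imsetP[x xX ->] /imsetP[x' x'X ->]; apply: yy.
  + apply: swap_compat => p q /imsetP[z zZ ->] /imsetP[z' z'Z ->]; exact: ww.
  + move=> p [a b] /imsetP[x xX ->]; rewrite in_swap => /imsetP[z zZ [-> ->]]; exact: yw.
- by move=> u /small1[].
- by move=> b /small2[].
- apply: leq_trans cB; apply: leq_add; apply/subset_leq_card/subsetP=> a /setIdP[aM lta]; apply/setIdP.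
    move: aM; rewrite in_setC => aM; have [aX _] := small1 a aM; rewrite in_setC aX; split=> //.
    have := leq_trans lta (forb1 a aM); rewrite ltn_add2r.
    by rewrite ltn_divLR // mulnC.
  move: aM; rewrite in_setC => aM; have [aX _] := small2 a aM; rewrite in_setC aX; split=> //.
  have := leq_trans lta (forb2 a aM); rewrite ltn_add2r.
  by rewrite ltn_divLR // mulnC.
- move=> u uM; have [uX _] := small1 u uM; have := forb1 u uM; have := Lw u uX.
  move: room1 cM; rewrite cT1; move: (forbidden _ _ _ _) (load _ _ _ _ _ _) #|M| #|X| #|Z|.
  move: (t * c) (kappa * t); clear; lia.
- move=> b bM; have [bZ _] := small2 b bM; have := forb2 b bM; have := Ly b bZ.
  move: room1 cM; rewrite cT1; move: (forbidden _ _ _ _) (load _ _ _ _ _ _) #|M| #|X| #|Z|.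
  move: (t * c) (kappa * t); clear; lia.
- move: room2 cM; rewrite cT1; move: #|M| #|X| #|Z| (t * t) (kappa * t); clear; lia.
Qed.

(** * Numerical estimates *)

Lemma root_lower_bound t0 n t : 5 * (t0 * t0) <= n -> n < 5 * (t.+1 * t.+1) -> t0 <= t.
Proof.
move=> le_n lt_n; rewrite -ltnS ltnNge; apply/negP => lt_t.
by have := leq_mul lt_t lt_t; lia.
Qed.

(** [(j * q) ^ 2] is at most [s * q ^ 2], hence at most [n ^ 2]; this turns a bound on [j * j] into
    a linear one. *)
Lemma square_root_linear a b q n s j :
  b * s <= a * n -> a * (q * q) <= b * n -> 0 < b -> j * j <= s -> j * q <= n.
Proof.
move=> le_s le_q b0 le_j; rewrite leqNgt; apply/negP => lt_n.
have h1 : n * n < (j * q) * (j * q) by apply: ltn_mul.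
have h2 : b * ((j * j) * (q * q)) <= (b * s) * (q * q).
  by rewrite -(mulnA b s) leq_mul2l leq_mul2r le_j !orbT.
have h3 : (b * s) * (q * q) <= (a * n) * (q * q) by rewrite leq_mul2r le_s orbT.
have h4 : (a * n) * (q * q) <= b * (n * n).
  by rewrite mulnAC (mulnA b) leq_mul2r le_q orbT.
have h5 : b * (n * n) < b * ((j * q) * (j * q)) by rewrite ltn_mul2l b0.
by move: h5; rewrite (mulnACA j q) => h5; move: (leq_ltn_trans (leq_trans h2 (leq_trans h3 h4)) h5); rewrite ltnn.
Qed.

Lemma quotient_bound beta b c S : b * c <= S -> S < beta.+1 * c -> b <= beta.
Proof.
move=> le_S lt_S; rewrite -ltnS -(ltn_pmul2r (m := c)) ?(leq_ltn_trans le_S) //.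
by case: c {le_S} lt_S => //; rewrite muln0.
Qed.

(* The range of [n] is cut into intervals on which [t], [j], [b] and [sg] have linear bounds; the cut points and the
   coefficients were found numerically. In the estimates [X] and [Z] are the numbers of hubs, [j] bounds the number of
   neighbours of a hub among the larger hubs, and [b], [sg] are numbers of heavily loaded vertices. *)
Section Arithmetic.

Variables n t s1 s2 D X Z : nat.
Hypotheses (t_le : 5 * (t * t) <= n) (t_gt : n < 5 * (t.+1 * t.+1)).
Hypotheses (bnd : s1 + s2 + 2 * D + 2 * (11 * (195 * 195)) <= 6 * n) (le21 : s2 <= s1).
Hypotheses (X_le : X * t <= s1) (Z_le : Z * t <= s2) (D1 : 2 * D <= s1) (Dn : 20 * D <= 19 * n).

(** Already [C_const <= 3 * n] gives [n >= 139425], and 166 is the largest integer that this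
    allows. *)
Lemma n_ge166 : 5 * (166 * 166) <= n.
Proof. by move: bnd; clear; lia. Qed.

Lemma t_linear t0 : t0 <= t -> 5 * t0 * t <= n.
Proof. by move=> le_t; apply: leq_trans t_le; rewrite -mulnA leq_mul2l leq_mul2r le_t !orbT. Qed.

Lemma X_linear t0 : t0 <= t -> X * t0 <= s1.
Proof. by move=> le_t; apply: leq_trans X_le; rewrite leq_mul2l le_t orbT. Qed.

Lemma Z_linear t0 : t0 <= t -> Z * t0 <= s2.
Proof. by move=> le_t; apply: leq_trans Z_le; rewrite leq_mul2l le_t orbT. Qed.

Lemma t_mul b beta : b <= beta -> t * b <= beta * t.
Proof. by move=> le_b; rewrite mulnC leq_mul2r le_b orbT. Qed.

Lemma room_pool0 p b j : n <= 12 * p -> j * j <= s1 -> b * (n %/ 2 - X) <= 3 * s1 ->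
  X + 3 * j + t * b < p.
Proof.
have n166 := n_ge166 => np js bs.
have [lt_n|ge_n] := ltnP n (5 * (380 * 380)).
  have ht := root_lower_bound n166 t_gt.
  have h1 := t_linear ht; have h2 := X_linear ht.
  have h3 : j * 168 <= n by apply: (@square_root_linear 485 100 168 n s1 j) => //; move: lt_n n166 bnd; clear; lia.
  have /t_mul h4 : b <= 30 by apply: quotient_bound bs _; move: lt_n n166 bnd h2; clear; lia.
  by move: np h1 h2 h3 h4 lt_n n166 bnd; move: (t * b); clear; lia.
have ht := root_lower_bound ge_n t_gt.
have h1 := t_linear ht; have h2 := X_linear ht.
have h3 : j * 346 <= n by apply: (@square_root_linear 6 1 346 n s1 j) => //; move: ge_n bnd; clear; lia.
have /t_mul h4 : b <= 37 by apply: quotient_bound bs _; move: ge_n bnd h2; clear; lia.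
by move: np h1 h2 h3 h4 ge_n bnd; move: (t * b); clear; lia.
Qed.

Lemma room_low h p b j : 12 * h <= s1 -> n <= h + p -> j * j <= s2 ->
  b * (n %/ 2 - Z) <= 11 * s2 -> Z + 11 * j + t * b < p.
Proof.
have n166 := n_ge166 => hs np js bs; have ht := root_lower_bound n166 t_gt.
have h1 := t_linear ht; have h2 := Z_linear ht.
have h3 : j * 214 <= n by apply: (@square_root_linear 3 1 214 n s2 j) => //; move: le21 n166 bnd; clear; lia.
have /t_mul h4 : b <= 68 by apply: quotient_bound bs _; move: le21 n166 bnd h2; clear; lia.
by move: np h1 h2 h3 h4 hs n166 bnd le21; move: (t * b); clear; lia.
Qed.

Lemma t_mul_count c k t0 : 2 * (n * c) <= k -> t0 <= t -> 10 * t0 * (t * c) <= k.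
Proof.
move=> le_k le_t; apply: leq_trans le_k; rewrite -[10]/(2 * 5) -!mulnA leq_mul2l /=.
by rewrite !mulnA leq_mul2r; have := t_linear le_t; rewrite -mulnA => ->; rewrite orbT.
Qed.

Lemma room_final_space k c : 2 * (n * c) <= k -> k <= 15 * s1 + 55 * s2 ->
  5 * (X + Z + c + 2 * (11 * t + t * t) + 1) + 2 * n < 5 * n.
Proof.
have n166 := n_ge166 => le_c le_k; have ht := root_lower_bound n166 t_gt.
have h1 := t_linear ht; have h2 := Z_linear ht; have h3 := X_linear ht.
have h4 := t_mul_count le_c ht; have h5 : 166 * c <= t * c by rewrite leq_mul2r ht orbT.
move: h1 h2 h3 h4 h5 le_k n166 bnd le21 t_le; move: (t * c) (t * t); clear; lia.
Qed.

(** The coefficients are [5 * 3] and [5 * 11]: [heavy_count] with at most 3 and at most 11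
    neighbours of a position. The coefficient 5 of [room_final1] is [5 * 1]. *)
Lemma room_final0 c : 2 * (n * c) <= 15 * s1 + 55 * s2 ->
  maxn (n %/ 2) D + 11 * t + X + Z + c + t * c <= n.
Proof.
move=> le_c.
have main t0 : t0 <= t -> [/\ 5 * t0 * t <= n, Z * t0 <= s2, X * t0 <= s1,
    10 * t0 * (t * c) <= 15 * s1 + 55 * s2 & t0 * c <= t * c].
  move=> ht; split; [exact: t_linear|exact: Z_linear|exact: X_linear|exact: t_mul_count|].
  by rewrite leq_mul2r ht orbT.
have n166 := n_ge166.
have [lt0|ge0] := ltnP n (5 * (270 * 270)).
  have [] := main _ (root_lower_bound n166 t_gt).
  by move: lt0 n166 bnd le21 D1 Dn; move: (t * c); clear; lia.
have [lt1|ge1] := ltnP n (5 * (350 * 350)).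
  have [] := main _ (root_lower_bound ge0 t_gt).
  by move: lt1 ge0 bnd le21 D1 Dn; move: (t * c); clear; lia.
have [lt2|ge2] := ltnP n (5 * (450 * 450)).
  have [] := main _ (root_lower_bound ge1 t_gt).
  by move: lt2 ge1 bnd le21 D1 Dn; move: (t * c); clear; lia.
have [lt3|ge3] := ltnP n (5 * (700 * 700)).
  have [] := main _ (root_lower_bound ge2 t_gt).
  by move: lt3 ge2 bnd le21 D1 Dn; move: (t * c); clear; lia.
have [lt4|ge4] := ltnP n (5 * (1300 * 1300)).
  have [] := main _ (root_lower_bound ge3 t_gt).
  by move: lt4 ge3 bnd le21 D1 Dn; move: (t * c); clear; lia.
have [] := main _ (root_lower_bound ge4 t_gt).
by move: ge4 bnd le21 D1 Dn; move: (t * c); clear; lia.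
Qed.

Section FewPool0.

Hypothesis few0 : 11 * n <= 12 * Z + 6 * s2.

(** Now [s2], and so [s1], is nearly [11 * n / 6] or more, and the constant forces a larger [n]. A
    larger [t] makes [Z] smaller, so the estimate is run twice. *)
Lemma n_ge266 : 5 * (266 * 266) <= n.
Proof.
have h1 : 5 * (264 * 264) <= n.
  have := Z_linear (root_lower_bound n_ge166 t_gt).
  by move: few0 bnd le21; clear; lia.
have := Z_linear (root_lower_bound h1 t_gt).
by move: few0 bnd le21; clear; lia.
Qed.

(** [p] is the size of the pool, [l] the part of it next to the top hub, [sg] the number of
    saturated hubs. Either the part next to the top hub is large enough alone, or [l] is small and
    removing [sg + 2] such parts is affordable. *)
Lemma room_pool1 p l sg b j : 11 * n <= 12 * Z + 12 * p + 3 * s2 -> j * j <= s1 ->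
  sg * (n %/ 2 - X) <= s1 -> b * (n %/ 2 - X) <= s1 ->
  X + 2 * j + (24 + 22 * t) + t * b < l \/
  X + 2 * j + (24 + 22 * t) + t * b + sg.+2 * l + 5 < p.
Proof.
move=> p_ge js sgs bs; have [small_l|] := leqP l (X + 2 * j + (24 + 22 * t) + t * b); [right|by left].
have n266 := n_ge266.
have [lt0|ge0] := ltnP n (5 * (330 * 330)).
  have ht := root_lower_bound n266 t_gt.
  have h1 := t_linear ht; have h2 := X_linear ht; have h5 := Z_linear ht.
  have h6 : 100 * s1 <= 266 * n by move: lt0 n266 h5 few0 bnd; clear; lia.
  have h3 : j * 364 <= n by apply: (@square_root_linear 266 100 364 n s1 j) => //; move: n266; clear; lia.
  have b_le : b <= 5 by apply: quotient_bound bs _; move: n266 h2 h6; clear; lia.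
  have sg_le : sg <= 5 by apply: quotient_bound sgs _; move: n266 h2 h6; clear; lia.
  have h4 := t_mul b_le.
  move: lt0 n266 h1 h2 h3 h4 h5 h6 sg_le sgs few0 p_ge bnd le21 small_l; move: (t * b); clear.
  (* [sg.+2 * l] is not linear, so the few possible values of [sg] are treated separately. *)
  by do 6?[case: sg => [|sg]; first by lia]; lia.
have [lt1|ge1] := ltnP n (5 * (426 * 426)).
  have ht := root_lower_bound ge0 t_gt.
  have h1 := t_linear ht; have h2 := X_linear ht; have h5 := Z_linear ht.
  have h6 : 100 * s1 <= 328 * n by move: lt1 ge0 h5 few0 bnd; clear; lia.
  have h3 : j * 407 <= n by apply: (@square_root_linear 328 100 407 n s1 j) => //; move: ge0; clear; lia.
  have b_le : b <= 6 by apply: quotient_bound bs _; move: ge0 h2 h6; clear; lia.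
  have sg_le : sg <= 6 by apply: quotient_bound sgs _; move: ge0 h2 h6; clear; lia.
  have h4 := t_mul b_le.
  move: lt1 ge0 h1 h2 h3 h4 h5 h6 sg_le sgs few0 p_ge bnd le21 small_l; move: (t * b); clear.
  by do 7?[case: sg => [|sg]; first by lia]; lia.
have [lt2|ge2] := ltnP n (5 * (600 * 600)).
  have ht := root_lower_bound ge1 t_gt.
  have h1 := t_linear ht; have h2 := X_linear ht; have h5 := Z_linear ht.
  have h6 : 100 * s1 <= 374 * n by move: lt2 ge1 h5 few0 bnd; clear; lia.
  have h3 : j * 492 <= n by apply: (@square_root_linear 374 100 492 n s1 j) => //; move: ge1; clear; lia.
  have b_le : b <= 7 by apply: quotient_bound bs _; move: ge1 h2 h6; clear; lia.
  have sg_le : sg <= 7 by apply: quotient_bound sgs _; move: ge1 h2 h6; clear; lia.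
  have h4 := t_mul b_le.
  move: lt2 ge1 h1 h2 h3 h4 h5 h6 sg_le sgs few0 p_ge bnd le21 small_l; move: (t * b); clear.
  by do 8?[case: sg => [|sg]; first by lia]; lia.
have [lt3|ge3] := ltnP n (5 * (802 * 802)).
  have ht := root_lower_bound ge2 t_gt.
  have h1 := t_linear ht; have h2 := X_linear ht; have h5 := Z_linear ht.
  have h6 : 100 * s1 <= 394 * n by move: lt3 ge2 h5 few0 bnd; clear; lia.
  have h3 : j * 675 <= n by apply: (@square_root_linear 394 100 675 n s1 j) => //; move: ge2; clear; lia.
  have b_le : b <= 7 by apply: quotient_bound bs _; move: ge2 h2 h6; clear; lia.
  have sg_le : sg <= 7 by apply: quotient_bound sgs _; move: ge2 h2 h6; clear; lia.
  have h4 := t_mul b_le.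
  move: lt3 ge2 h1 h2 h3 h4 h5 h6 sg_le sgs few0 p_ge bnd le21 small_l; move: (t * b); clear.
  by do 8?[case: sg => [|sg]; first by lia]; lia.
have ht := root_lower_bound ge3 t_gt.
have h1 := t_linear ht; have h2 := X_linear ht; have h5 := Z_linear ht.
have h6 : 100 * s1 <= 420 * n by move: ge3 h5 few0 bnd; clear; lia.
have h3 : j * 875 <= n by apply: (@square_root_linear 420 100 875 n s1 j) => //; move: ge3; clear; lia.
have b_le : b <= 8 by apply: quotient_bound bs _; move: ge3 h2 h6; clear; lia.
have sg_le : sg <= 8 by apply: quotient_bound sgs _; move: ge3 h2 h6; clear; lia.
have h4 := t_mul b_le.
move: ge3 h1 h2 h3 h4 h5 h6 sg_le sgs few0 p_ge bnd le21 small_l; move: (t * b); clear.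
by do 9?[case: sg => [|sg]; first by lia]; lia.
Qed.

Lemma room_far h b j : 12 * h <= s1 -> j * j <= s2 -> b * (n %/ 2 - Z) <= 11 * s2 ->
  Z + 11 * j + (12 + 11 * t) + t * b + h + n %/ 2 < n.
Proof.
move=> hs js bs; have n266 := n_ge266.
have ht := root_lower_bound n266 t_gt.
have h1 := t_linear ht; have h5 := Z_linear ht.
have h6 : 100 * s2 <= 300 * n by move: n266 le21 bnd; clear; lia.
have h3 : j * 343 <= n by apply: (@square_root_linear 300 100 343 n s2 j) => //; move: n266; clear; lia.
have h4 : t * b <= 67 * t by apply: t_mul; apply: quotient_bound bs _; move: n266 h5 h6; clear; lia.
by move: n266 h1 h3 h4 h5 h6 hs few0 bnd le21 ; move: (t * b); clear; lia.
Qed.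

(** The case where one hub of degree [d], perhaps near [19 * n / 20], is to be avoided: a large [d]
    leaves few edges for the [h] vertices of degree at least 12. *)
Lemma room_far_single h d b j : 12 * h + 2 * d <= s1 -> d <= D -> j * j <= s2 ->
  b * (n %/ 2 - Z) <= 11 * s2 -> Z + 11 * j + (12 + 11 * t) + t * b + h + d.+1 < n.
Proof.
move=> hs dD js bs; have n266 := n_ge266.
have [lt0|ge0] := ltnP n (5 * (330 * 330)).
  have ht := root_lower_bound n266 t_gt.
  have h1 := t_linear ht; have h5 := Z_linear ht.
  have h6 : 100 * s2 <= 224 * n by move: lt0 n266 le21 bnd; clear; lia.
  have h3 : j * 397 <= n by apply: (@square_root_linear 224 100 397 n s2 j) => //; move: n266; clear; lia.
  have h4 : t * b <= 50 * t by apply: t_mul; apply: quotient_bound bs _; move: n266 h5 h6; clear; lia.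
  by move: lt0 n266 h1 h3 h4 h5 h6 hs few0 bnd le21 dD Dn; move: (t * b); clear; lia.
have [lt1|ge1] := ltnP n (5 * (450 * 450)).
  have ht := root_lower_bound ge0 t_gt.
  have h1 := t_linear ht; have h5 := Z_linear ht.
  have h6 : 100 * s2 <= 259 * n by move: lt1 ge0 le21 bnd; clear; lia.
  have h3 : j * 458 <= n by apply: (@square_root_linear 259 100 458 n s2 j) => //; move: ge0; clear; lia.
  have h4 : t * b <= 57 * t by apply: t_mul; apply: quotient_bound bs _; move: ge0 h5 h6; clear; lia.
  by move: lt1 ge0 h1 h3 h4 h5 h6 hs few0 bnd le21 dD Dn; move: (t * b); clear; lia.
have [lt2|ge2] := ltnP n (5 * (580 * 580)).
  have ht := root_lower_bound ge1 t_gt.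
  have h1 := t_linear ht; have h5 := Z_linear ht.
  have h6 : 100 * s2 <= 276 * n by move: lt2 ge1 le21 bnd; clear; lia.
  have h3 : j * 605 <= n by apply: (@square_root_linear 276 100 605 n s2 j) => //; move: ge1; clear; lia.
  have h4 : t * b <= 61 * t by apply: t_mul; apply: quotient_bound bs _; move: ge1 h5 h6; clear; lia.
  by move: lt2 ge1 h1 h3 h4 h5 h6 hs few0 bnd le21 dD Dn; move: (t * b); clear; lia.
have [lt3|ge3] := ltnP n (5 * (680 * 680)).
  have ht := root_lower_bound ge2 t_gt.
  have h1 := t_linear ht; have h5 := Z_linear ht.
  have h6 : 100 * s2 <= 282 * n by move: lt3 ge2 le21 bnd; clear; lia.
  have h3 : j * 772 <= n by apply: (@square_root_linear 282 100 772 n s2 j) => //; move: ge2; clear; lia.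
  have h4 : t * b <= 62 * t by apply: t_mul; apply: quotient_bound bs _; move: ge2 h5 h6; clear; lia.
  by move: lt3 ge2 h1 h3 h4 h5 h6 hs few0 bnd le21 dD Dn; move: (t * b); clear; lia.
have [lt4|ge4] := ltnP n (5 * (800 * 800)).
  have ht := root_lower_bound ge3 t_gt.
  have h1 := t_linear ht; have h5 := Z_linear ht.
  have h6 : 100 * s2 <= 287 * n by move: lt4 ge3 le21 bnd; clear; lia.
  have h3 : j * 897 <= n by apply: (@square_root_linear 287 100 897 n s2 j) => //; move: ge3; clear; lia.
  have h4 : t * b <= 63 * t by apply: t_mul; apply: quotient_bound bs _; move: ge3 h5 h6; clear; lia.
  by move: lt4 ge3 h1 h3 h4 h5 h6 hs few0 bnd le21 dD Dn; move: (t * b); clear; lia.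
have [lt5|ge5] := ltnP n (5 * (950 * 950)).
  have ht := root_lower_bound ge4 t_gt.
  have h1 := t_linear ht; have h5 := Z_linear ht.
  have h6 : 100 * s2 <= 291 * n by move: lt5 ge4 le21 bnd; clear; lia.
  have h3 : j * 1048 <= n by apply: (@square_root_linear 291 100 1048 n s2 j) => //; move: ge4; clear; lia.
  have h4 : t * b <= 64 * t by apply: t_mul; apply: quotient_bound bs _; move: ge4 h5 h6; clear; lia.
  by move: lt5 ge4 h1 h3 h4 h5 h6 hs few0 bnd le21 dD Dn; move: (t * b); clear; lia.
have [lt6|ge6] := ltnP n (5 * (1150 * 1150)).
  have ht := root_lower_bound ge5 t_gt.
  have h1 := t_linear ht; have h5 := Z_linear ht.
  have h6 : 100 * s2 <= 294 * n by move: lt6 ge5 le21 bnd; clear; lia.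
  have h3 : j * 1238 <= n by apply: (@square_root_linear 294 100 1238 n s2 j) => //; move: ge5; clear; lia.
  have h4 : t * b <= 65 * t by apply: t_mul; apply: quotient_bound bs _; move: ge5 h5 h6; clear; lia.
  by move: lt6 ge5 h1 h3 h4 h5 h6 hs few0 bnd le21 dD Dn; move: (t * b); clear; lia.
have [lt7|ge7] := ltnP n (5 * (1500 * 1500)).
  have ht := root_lower_bound ge6 t_gt.
  have h1 := t_linear ht; have h5 := Z_linear ht.
  have h6 : 100 * s2 <= 297 * n by move: lt7 ge6 le21 bnd; clear; lia.
  have h3 : j * 1492 <= n by apply: (@square_root_linear 297 100 1492 n s2 j) => //; move: ge6; clear; lia.
  have h4 : t * b <= 65 * t by apply: t_mul; apply: quotient_bound bs _; move: ge6 h5 h6; clear; lia.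
  by move: lt7 ge6 h1 h3 h4 h5 h6 hs few0 bnd le21 dD Dn; move: (t * b); clear; lia.
have ht := root_lower_bound ge7 t_gt.
have h1 := t_linear ht; have h5 := Z_linear ht.
have h6 : 100 * s2 <= 300 * n by move: ge7 le21 bnd; clear; lia.
have h3 : j * 1936 <= n by apply: (@square_root_linear 300 100 1936 n s2 j) => //; move: ge7; clear; lia.
have h4 : t * b <= 66 * t by apply: t_mul; apply: quotient_bound bs _; move: ge7 h5 h6; clear; lia.
by move: ge7 h1 h3 h4 h5 h6 hs few0 bnd le21 dD Dn; move: (t * b); clear; lia.
Qed.

Lemma room_final1 c : 2 * (n * c) <= 5 * s1 + 55 * s2 ->
  maxn (n %/ 2) D + 11 * t + X + Z + (c + 33) + t * (c + 33) <= n.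
Proof.
move=> le_c.
have main t0 : t0 <= t -> [/\ 5 * t0 * t <= n, Z * t0 <= s2, X * t0 <= s1,
    10 * t0 * (t * c) <= 5 * s1 + 55 * s2 & t0 * c <= t * c].
  move=> ht; split; [exact: t_linear|exact: Z_linear|exact: X_linear|exact: t_mul_count|].
  by rewrite leq_mul2r ht orbT.
have n266 := n_ge266.
have [lt0|ge0] := ltnP n (5 * (330 * 330)).
  have [] := main _ (root_lower_bound n266 t_gt).
  by move: lt0 n266 few0 bnd le21 D1 Dn; rewrite mulnDr; move: (t * c); clear; lia.
have [lt1|ge1] := ltnP n (5 * (420 * 420)).
  have [] := main _ (root_lower_bound ge0 t_gt).
  by move: lt1 ge0 few0 bnd le21 D1 Dn; rewrite mulnDr; move: (t * c); clear; lia.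
have [lt2|ge2] := ltnP n (5 * (572 * 572)).
  have [] := main _ (root_lower_bound ge1 t_gt).
  by move: lt2 ge1 few0 bnd le21 D1 Dn; rewrite mulnDr; move: (t * c); clear; lia.
have [] := main _ (root_lower_bound ge2 t_gt).
by move: ge2 few0 bnd le21 D1 Dn; rewrite mulnDr; move: (t * c); clear; lia.
Qed.

(** When [s1] is close to [4 * n], the lower bound on [s2] leaves little of [6 * n] for [D]. *)
Lemma few_hubs_dichotomy : 4 * X + s1 < 4 * n \/ 4 * D <= n /\ 6 * X + s1 < 6 * n.
Proof.
have n266 := n_ge266; have ht := root_lower_bound n266 t_gt.
have := Z_linear ht; have := X_linear ht.
by move: n266 few0 bnd le21; clear; lia.
Qed.

Lemma room_low_far h d : 12 * h + 2 * d <= s2 -> d <= D -> h + d + 25 <= n.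
Proof. by move: bnd le21; clear; lia. Qed.

End FewPool0.

Lemma room_final_space33 c : 2 * (n * c) <= 5 * s1 + 55 * s2 ->
  5 * (X + Z + (c + 33) + 2 * (11 * t + t * t) + 1) + 2 * n < 5 * n.
Proof.
have n166 := n_ge166 => le_c; have ht := root_lower_bound n166 t_gt.
have h1 := t_linear ht; have h2 := Z_linear ht; have h3 := X_linear ht.
have h4 := t_mul_count le_c ht; have h5 : 166 * c <= t * c by rewrite leq_mul2r ht orbT.
move: h1 h2 h3 h4 h5 n166 bnd le21 t_le; move: (t * c) (t * t); clear; lia.
Qed.

End Arithmetic.

(** * Pools of vertices with few hub neighbours *)

Section Pools.

Variables (T : finType) (e : rel T).
Hypothesis sym : symmetric e.

Lemma hubs_le t : #|hubs e t| * t <= degsum e.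
Proof.
rewrite -sum_nat_const; apply: leq_trans (degsum_sub e (hubs e t)).
by apply: leq_sum => v; rewrite inE.
Qed.

Definition low : {set T} := [set v | #|nbh e v| <= 11].

Variable X : {set T}.

Definition hub_degree v := #|nbh e v :&: X|.
Definition free_degree v := #|nbh e v :\: X|.

Lemma degree_split v : #|nbh e v| = hub_degree v + free_degree v.
Proof. by rewrite /hub_degree /free_degree cardsID. Qed.

(* Every edge is counted at most twice: the edges between [X] and its complement, once for each term. *)
Lemma cost_sum : \sum_(v in ~: X) (2 * hub_degree v + free_degree v) <= degsum e.
Proof.
rewrite /degsum [X in _ <= X](bigID (mem X)) /=.
rewrite (eq_bigr (fun v => hub_degree v + #|nbh e v|)); last first.
  by move=> v _; rewrite mul2n -addnn -addnA -degree_split.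
rewrite big_split /=; apply: leq_add; last first.
  by rewrite (eq_bigl (fun v => v \notin X)) // => v; rewrite inE.
rewrite -exchange_nbh //; apply: leq_sum => v _.
exact: subset_leq_card (subsetIl _ _).
Qed.

(** Markov's inequality for the cost [2 * hub_degree v + free_degree v]. *)
Lemma cheap_count k (P : {set T}) :
  (forall v, v \notin X -> v \notin P -> k <= 2 * hub_degree v + free_degree v) ->
  k * #|T| <= k * (#|X| + #|P|) + degsum e.
Proof.
move=> dear; have := markov_card (~: X) (fun v => 2 * hub_degree v + free_degree v) k.
move=> /leq_trans /(_ cost_sum); set R := [set v in _ | _] => leR.
have : #|[set: T]| <= #|X :|: P :|: R|.
  apply/subset_leq_card/subsetP=> v _; rewrite !in_setU -orbA.
  have [//|vX] := boolP (v \in X); have [//|vP] := boolP (v \in P).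
  by rewrite /R !inE vX dear.
rewrite cardsT; have := card_setU_le (X :|: P) R; have := card_setU_le X P.
move: leR; move: #|R| #|X :|: P| #|_ :|: R| #|X| #|P| #|T| => r u a b c d; clear; nia.
Qed.

(** [pool0] and [pool1] together are the vertices outside [X] of cost at most 3. *)
Definition pool0 : {set T} := [set v in ~: X | (hub_degree v == 0) && (free_degree v <= 3)].
Definition pool1 : {set T} := [set v in ~: X | (hub_degree v == 1) && (free_degree v <= 1)].

Lemma pool0_count : 2 * #|T| <= 2 * (#|X| + #|pool0|) + degsum e.
Proof. by apply: cheap_count => v vX; rewrite !inE vX /=; lia. Qed.

Lemma pool01_count : 4 * #|T| <= 4 * (#|X| + (#|pool0| + #|pool1|)) + degsum e.
Proof.
have := @cheap_count 4 (pool0 :|: pool1).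
have := card_setU_le pool0 pool1.
move=> le01 /(_ _)/leq_trans; apply; last by rewrite leq_add2r leq_mul2l leq_add2l le01.
by move=> v vX; rewrite !inE vX /=; lia.
Qed.

(** A vertex with more than [h] hub neighbours costs at least [2 * h.+1], and so does one of degree
    at least 12, because [h <= 5]. *)
Lemma exists_few_hubs h : h <= 5 -> 2 * h.+1 * #|X| + degsum e < 2 * h.+1 * #|T| ->
  exists v, [/\ v \notin X, #|nbh e v| <= 11 & hub_degree v <= h].
Proof.
move=> h5 room; pose P := [set v in ~: X | (#|nbh e v| <= 11) && (hub_degree v <= h)].
have [P0|[v]] := set_0Vmem P; last first.
  by rewrite !inE => /andP[vX /andP[v11 vh]]; exists v.
have := @cheap_count (2 * h.+1) P; rewrite P0 cards0 addn0 => /(_ _)/(leq_trans _).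
move=> H; have : 2 * h.+1 * #|T| <= 2 * h.+1 * #|X| + degsum e; last by rewrite leqNgt room.
apply: H => // v vX _; have : v \notin P by rewrite P0 inE.
by rewrite !inE vX /= degree_split; lia.
Qed.

End Pools.

Lemma card_setD_gt (T : finType) (P C : {set T}) k : k + #|C| < #|P| -> k < #|P :\: C|.
Proof.
rewrite -(cardsID C P) => h; rewrite -(ltn_add2r #|C|); apply: leq_trans h _.
by rewrite addnC leq_add2l; apply: subset_leq_card (subsetIr _ _).
Qed.

Section Loads.

Variables (T1 T2 : finType) (e1 : rel T1) (e2 : rel T2) (X : {set T1}).
Hypothesis sym1 : symmetric e1.

Lemma heavy_count (M : {set T2}) k (y : T1 -> T2) n :
  (forall x, x \in X -> #|nbh e2 (y x) :&: M| <= k) ->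
  2 * (n * #|[set b in M | n < 5 * load e1 e2 X X y b]|) <= 5 * (k * degsum e1).
Proof.
move=> kP; have := sum_load sym1 (subxx X) kP.
have := markov_card M (fun b => 5 * load e1 e2 X X y b) n.+1.
rewrite -big_distrr /=; move: (\sum_(b in M) _) => S.
set c := #|_|; rewrite mulnS => h1 h2; have : n * c <= 5 * S.
  by apply: leq_trans h1; rewrite mulnC leq_addl.
move: h2; move: (n * c) (k * _) => a b; clear; lia.
Qed.

Lemma load_single (X' : {set T1}) (y : T1 -> T2) b D : (forall x, #|nbh e1 x| <= D) ->
  #|[set x in X' | e2 (y x) b]| <= 1 -> load e1 e2 X X' y b <= D.
Proof.
move=> leD c1; rewrite /load.
apply: (@leq_trans (\sum_(x in X' | e2 (y x) b) D)).
  by apply: leq_sum => x _; apply: leq_trans (leD x); apply: subset_leq_card (subsetDl _ _).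
rewrite sum_nat_const -[X in _ <= X]mul1n leq_mul2r; apply/orP; right.
by apply: leq_trans c1; apply/subset_leq_card/subsetP=> x; rewrite !inE.
Qed.

Lemma card_cover_nbh (T : finType) (e : rel T) (B : {set T}) t :
  (forall b, b \in B -> #|nbh e b| <= t) -> #|cover_nbh e B| <= t * #|B|.
Proof.
move=> small; apply: leq_trans (card_bigcup_le _ _) _; rewrite mulnC -sum_nat_const.
exact: leq_sum.
Qed.

End Loads.

(** * No vertex adjacent to almost everything *)

Section NoDominating.

Variables (T1 T2 : finType) (e1 : rel T1) (e2 : rel T2) (n t D : nat).
Hypotheses (irr1 : irreflexive e1) (sym1 : symmetric e1).
Hypotheses (irr2 : irreflexive e2) (sym2 : symmetric e2).
Hypotheses (cT1 : #|T1| = n) (cT2 : #|T2| = n).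
Hypotheses (D1 : forall v, #|nbh e1 v| <= D) (D2 : forall v, #|nbh e2 v| <= D).
Hypotheses (D1s : 2 * D <= degsum e1) (le21 : degsum e2 <= degsum e1).
Hypothesis bnd : degsum e1 + degsum e2 + 2 * D + 2 * (11 * (195 * 195)) <= 6 * n.
Hypotheses (Dn : 20 * D <= 19 * n) (t_le : 5 * (t * t) <= n) (t_gt : n < 5 * (t.+1 * t.+1)).

Let X := hubs e1 t.
Let Z := hubs e2 t.

Lemma X_le : #|X| * t <= degsum e1. Proof. exact: hubs_le. Qed.
Lemma Z_le : #|Z| * t <= degsum e2. Proof. exact: hubs_le. Qed.

Lemma t_ge166 : 166 <= t.
Proof. exact: root_lower_bound (n_ge166 bnd) t_gt. Qed.

Lemma notX_small v : v \in ~: X -> #|nbh e1 v| <= t.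
Proof. by rewrite !inE -ltnNge => /ltnW. Qed.

Lemma notZ_small v : v \in ~: Z -> #|nbh e2 v| <= t.
Proof. by rewrite !inE -ltnNge => /ltnW. Qed.

Lemma low_notin_hubs (T : finType) (e : rel T) v : #|nbh e v| <= 11 -> v \notin hubs e t.
Proof. by move=> le11; rewrite inE -ltnNge (leq_ltn_trans le11) // (leq_trans _ t_ge166). Qed.

Lemma card_low1 : exists2 h, 12 * h <= degsum e1 & n <= h + #|low e1|.
Proof.
exists #|[set v in [set: T1] | 12 <= #|nbh e1 v|]|.
  by rewrite mulnC -[X in _ <= X]sum_setT_degsum; apply: markov_card.
rewrite -cT1 -cardsT; apply: leq_trans (card_setU_le _ _); apply/subset_leq_card/subsetP=> v _.
by rewrite !inE /= leqNgt ltnS orNb.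
Qed.

(** Vertices of [pool0] have no neighbour in [Z], so the hubs of [G1] placed there cannot conflict
    with those of [G2], which go independently to vertices of degree at most 11. Only non-hubs are
    monitored. *)
Lemma pool0_packable : n <= 12 * #|pool0 e2 Z| -> packable e1 e2.
Proof.
move=> big0.
have n0 : 0 < n by move: (n_ge166 bnd); clear; lia.
have [y0 _] : exists y0 : T1 -> T2, True.
  have /card_gt0P[b _] : 0 < #|T2| by rewrite cT2.
  by exists (fun=> b).
have [w0 _] : exists w0 : T2 -> T1, True.
  have /card_gt0P[b _] : 0 < #|T1| by rewrite cT1.
  by exists (fun=> b).
have poolE v : v \in pool0 e2 Z -> [/\ v \notin Z, nbh e2 v :&: Z = set0, #|nbh e2 v| <= 3 & #|nbh e2 v :&: ~: Z| <= 3].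
  rewrite 2!inE => /andP[vZ /andP[/eqP/cards0_eq v0 v3]]; split=> //.
    by rewrite (degree_split e2 Z) /hub_degree v0 cards0.
  by rewrite -setDE.
have [||y [injy py cy ly]] := @place_hubs _ _ e1 e2 irr1 sym1 sym2 X (fun=> pool0 e2 Z) set0 (~: Z) 3 0 3 (n %/ 2) _ _ y0.
- move=> x v xX /poolE[_ _ v3 vn]; split=> //; by rewrite setI0 cards0.
- move=> x B1 B2 j xX sB1 sB2 js _ bs.
  have small : #|cover_nbh e2 B2| <= t * #|B2|.
    by apply: card_cover_nbh => b /(subsetP sB2); apply: notZ_small.
  have -> : B1 = set0 by apply/eqP; rewrite -subset0.
  rewrite cover_nbh0 set0U; apply: card_setD_gt.
  apply: leq_ltn_trans (room_pool0 t_le t_gt bnd X_le big0 js bs).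
  by rewrite leq_add2l; exact: small.
have [h h12 low_n] := card_low1.
have [||w [injw pw cw lw]] := @place_hubs _ _ e2 e1 irr2 sym2 sym1 Z (fun=> low e1) set0 (~: X) 11 0 11 (n %/ 2) _ _ w0.
- move=> z v zZ; rewrite inE => v11; split=> //; first by rewrite setI0 cards0.
  by apply: leq_trans v11; apply: subset_leq_card (subsetIl _ _).
- move=> z B1 B2 j zZ sB1 sB2 js _ bs.
  have small : #|cover_nbh e1 B2| <= t * #|B2|.
    by apply: card_cover_nbh => b /(subsetP sB2); apply: notX_small.
  have -> : B1 = set0 by apply/eqP; rewrite -subset0.
  rewrite cover_nbh0 set0U; apply: card_setD_gt.
  apply: leq_ltn_trans (room_low t_le t_gt bnd le21 Z_le h12 low_n js bs).
  by rewrite leq_add2l; exact: small.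
pose U := [set u in ~: X | n < 5 * load e2 e1 Z Z w u].
pose B := [set b in ~: Z | n < 5 * load e1 e2 X X y b].
have cB : 2 * (n * #|B|) <= 5 * (3 * degsum e1).
  by apply: heavy_count => // x /py/poolE[].
have cU : 2 * (n * #|U|) <= 5 * (11 * degsum e2).
  apply: heavy_count => // z /pw; rewrite inE; apply: leq_trans.
  exact: subset_leq_card (subsetIl _ _).
have cUB : 2 * (n * (#|U| + #|B|)) <= 15 * degsum e1 + 55 * degsum e2.
  by move: cB cU; rewrite mulnDr; clear; lia.
apply: (@hub_completion _ _ e1 e2 y w t (#|U| + #|B|) 11 (maxn (n %/ 2) D) n) => //.
- move=> x /py/poolE[yZ _ y3 _]; split=> //; exact: leq_trans y3 _.
- by move=> z /pw; rewrite inE => w11; split=> //; apply: low_notin_hubs.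
- move=> x z xX zZ _; have [_ yZ _ _] := poolE _ (py x xX).
  by apply/negP => eyz; have := in_set0 z; rewrite -yZ in_setI in_nbh eyz zZ.
- move=> u uX; have [|leu|c1] := lw u; first by rewrite set0U inE.
    by rewrite leq_max leu.
  by rewrite leq_max; apply/orP; right; apply: load_single.
- move=> b bZ; have [|leb|c1] := ly b; first by rewrite set0U inE.
    by rewrite leq_max leb.
  by rewrite leq_max; apply/orP; right; apply: load_single.
- exact: (room_final0 t_le t_gt bnd le21 X_le Z_le D1s Dn cUB).
- exact: (room_final_space t_le t_gt bnd le21 X_le Z_le cUB (leqnn _)).
Qed.

Let P := pool1 e2 Z.
Hypothesis few_pool0 : 12 * #|pool0 e2 Z| < n.

Lemma few0 : 11 * n <= 12 * #|Z| + 6 * degsum e2.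
Proof.
have := pool0_count sym2 Z; rewrite cT2; move: few_pool0.
by move: #|Z| #|pool0 _ _|; clear; lia.
Qed.

Lemma card_pool1 : 11 * n <= 12 * #|Z| + 12 * #|P| + 3 * degsum e2.
Proof.
have := pool01_count sym2 Z; rewrite cT2 -/P; move: few_pool0.
by move: #|Z| #|pool0 _ _| #|P|; clear; lia.
Qed.

Lemma pool1P v : v \in P ->
  [/\ v \notin Z, #|nbh e2 v :&: Z| = 1, #|nbh e2 v :\: Z| <= 1 & #|nbh e2 v| <= 2].
Proof.
rewrite 2!inE => /andP[vZ /andP[/eqP v1 v2]]; split=> //.
by rewrite (degree_split e2 Z) v1.
Qed.

Lemma pool1_hub_unique v z z' : v \in P -> z \in Z -> z' \in Z -> e2 v z -> e2 v z' -> z = z'.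
Proof.
case/pool1P=> _ /eqP/cards1P[h hE] _ _ zZ z'Z evz evz'.
have : z \in nbh e2 v :&: Z by rewrite !in_setI in_nbh evz.
have : z' \in nbh e2 v :&: Z by rewrite !in_setI in_nbh evz'.
by rewrite hE !inE => /eqP-> /eqP->.
Qed.

Lemma top_hub : exists2 z1, z1 \in Z & forall z, z \in Z -> #|nbh e2 z :&: P| <= #|nbh e2 z1 :&: P|.
Proof.
have [z0 z0Z] : exists z0, z0 \in Z.
  have P0 : 0 < #|P|.
    have := card_pool1; have := Z_linear Z_le t_ge166; have := n_ge166 bnd.
    by move: le21 bnd; move: #|Z| #|P|; clear; lia.
  have /set0Pn[v /pool1P[_ /eqP/cards1P[h hE] _ _]] : P != set0 by rewrite -card_gt0.
  by exists h; have := set11 h; rewrite -hE inE => /andP[].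
by case: (arg_maxnP (P := fun z => z \in Z) (fun z => #|nbh e2 z :&: P|) z0Z) => z1; exists z1.
Qed.

(* The set spared here receives the hub neighbours of the vertex that is going to be sent to [z1]. *)
Lemma spare_vertices z1 : z1 \in Z ->
  (forall z, z \in Z -> #|nbh e2 z :&: P| <= #|nbh e2 z1 :&: P|) ->
  exists I : {set T2}, [/\ #|I| = 2, forall u v, u \in I -> v \in I -> ~~ e2 u v,
    forall v, v \in I -> ~~ e2 v z1 /\ #|nbh e2 v| <= 11 &
    #|P :&: cover_nbh e2 (cover_nbh e2 I :&: Z)| <= 2 * #|nbh e2 z1 :&: P| + 5].
Proof.
(* Six pool vertices of degree at most 2 contain two non-adjacent ones; each has a single hub
   neighbour, with no more pool neighbours than [z1]. *)
move=> z1Z maxz1; have [many|few] := ltnP 5 #|P :\: nbh e2 z1|.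
  have [||I [sI cI indI]] := @independent_subset _ e2 irr2 sym2 (P :\: nbh e2 z1) 2 2.
  - by move=> v /setDP[/pool1P[]].
  - exact: many.
  have IP v : v \in I -> v \in P /\ ~~ e2 v z1.
    by move/(subsetP sI)/setDP=> [vP]; rewrite inE sym2.
  exists I; split=> //.
    by move=> v /IP[/pool1P[_ _ _ v2] ez]; split=> //; apply: leq_trans v2 _.
  have cH : #|cover_nbh e2 I :&: Z| <= 2.
    have -> : cover_nbh e2 I :&: Z = \bigcup_(v in I) (nbh e2 v :&: Z) by rewrite big_distrl.
    apply: leq_trans (card_bigcup_le _ _) _; rewrite -cI -sum1_card.
    by apply: leq_sum => v /IP[/pool1P[_ ->]].
  have -> : P :&: cover_nbh e2 (cover_nbh e2 I :&: Z) =
      \bigcup_(h in cover_nbh e2 I :&: Z) (P :&: nbh e2 h) by rewrite big_distrr.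
  apply: leq_trans (card_bigcup_le _ _) _; apply: leq_trans (leq_addr _ _).
  apply: (@leq_trans (#|cover_nbh e2 I :&: Z| * #|nbh e2 z1 :&: P|)); last by rewrite leq_mul2r cH orbT.
  by rewrite -sum_nat_const; apply: leq_sum => h /setIP[_ /maxz1]; rewrite setIC.
(* Otherwise two vertices of degree at most 11 not adjacent to [z1] will do: a hub next to them is
   not [z1], so its pool neighbours are among the at most five outside the neighbourhood of [z1]. *)
pose far := ~: (z1 |: nbh e2 z1).
have sumfar := sum_far_degrees irr2 sym2 z1.
pose High := [set v in far | 12 <= #|nbh e2 v|].
have cHigh : #|High| * 12 <= \sum_(v in far) #|nbh e2 v| by apply: markov_card.
have cfar : #|far| + #|nbh e2 z1| + 1 = n.
  by rewrite -cT2 -(cardsC (z1 |: nbh e2 z1)) cardsU1 inE irr2 /far; lia.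
have cLow : #|far| <= #|High| + #|far :&: low e2|.
  apply: leq_trans (card_setU_le _ _); apply/subset_leq_card/subsetP=> v vfar.
  apply/setUP; have [d12|d11] := leqP 12 #|nbh e2 v|; [left|right].
    by rewrite inE vfar.
  by rewrite in_setI vfar inE -ltnS.
have [||I [sI cI indI]] := @independent_subset _ e2 irr2 sym2 (far :&: low e2) 2 11.
- by move=> v /setIP[_]; rewrite inE.
- have : 12 * #|High| + 2 * #|nbh e2 z1| <= degsum e2.
    by move: cHigh sumfar; rewrite -/far; clear; lia.
  move=> /(room_low_far bnd le21)/(_ (D2 _)).
  by move: cfar cLow; move: #|far| #|High| #|_ :&: _| #|nbh e2 z1|; clear; lia.
have IP v : v \in I -> [/\ v != z1, ~~ e2 v z1 & #|nbh e2 v| <= 11].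
  by move/(subsetP sI)/setIP=> []; rewrite !inE negb_or => /andP[-> ez] ->; rewrite sym2.
exists I; split=> //; first by move=> v /IP[].
apply: leq_trans (leq_addl _ _); apply: leq_trans few; apply/subset_leq_card/subsetP=> v.
case/setIP=> vP /bigcupP[h /setIP[/bigcupP[u uI] eu hZ]]; rewrite inE => ehv.
rewrite inE vP andbT inE; apply/negP => ez1v.
have hz1 : h = z1 by apply: (pool1_hub_unique vP) => //; rewrite sym2.
by have [_] := IP u uI; move: eu; rewrite inE hz1 => ->.
Qed.

(** [w0] is the future preimage of [z1]. Two hub neighbours are acceptable when [4 * D <= n], since
    their joint load is then at most [n / 2]. *)
Lemma seed : exists w0, [/\ w0 \notin X, #|nbh e1 w0| <= 11 &
  #|nbh e1 w0 :&: X| <= 1 \/ #|nbh e1 w0 :&: X| <= 2 /\ 4 * D <= n].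
Proof.
have [room|[D4 room]] := few_hubs_dichotomy t_gt bnd le21 X_le Z_le few0.
  have [||w0 [w0X w11 w1]] := exists_few_hubs sym1 (X := X) (h := 1) => //; first by rewrite cT1.
  by exists w0; split=> //; left.
have [||w0 [w0X w11 w2]] := exists_few_hubs sym1 (X := X) (h := 2) => //; first by rewrite cT1.
by exists w0; split=> //; right.
Qed.

(* The load of [z1] need not be controlled: the neighbours in [X] of the future preimage of [z1] all lie in [A], which is kept away from [z1]. If the neighbourhood of [z1] fills most of the pool, all of [X] but [A] may thus be placed there. *)
Lemma place_X z1 (A : {set T1}) : z1 \in Z ->
  (forall z, z \in Z -> #|nbh e2 z :&: P| <= #|nbh e2 z1 :&: P|) ->
  A \subset X -> #|A| <= 1 \/ #|A| <= 2 /\ 4 * D <= n ->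
  exists y : T1 -> T2,
    [/\ {in X &, injective y},
        forall x, x \in X -> y x \notin Z /\ #|nbh e2 (y x)| <= 11,
        forall x x', x \in X -> x' \in X -> e1 x x' -> ~~ e2 (y x) (y x'),
        forall x, x \in A -> ~~ e2 (y x) z1 &
        forall b, b != z1 ->
          load e1 e2 X X y b <= n %/ 2 \/ #|[set x in X | e2 (y x) b]| <= 1] /\
    exists2 c, #|[set b in ~: Z | n < 5 * load e1 e2 X X y b]| <= c + 22 &
      2 * (n * c) <= 5 * degsum e1.
Proof.
move=> z1Z maxz1 sAX cA.
have [I [cI indI IP cH]] := spare_vertices z1Z maxz1.
set H := cover_nbh e2 I :&: Z in cH.
have z1I : z1 \notin cover_nbh e2 I.
  by apply/negP => /bigcupP[v /IP[evz _]]; rewrite inE (negPf evz).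
pose Near := I :|: cover_nbh e2 I :|: cover_nbh e2 (cover_nbh e2 I :\: Z).
have cCov : #|cover_nbh e2 I| <= 22.
  by have := @card_cover_nbh _ e2 I 11; rewrite cI; apply=> v /IP[].
have cNear : #|Near| <= 24 + 22 * t.
  apply: leq_trans (card_setU_le _ _) (leq_add _ _).
    by apply: leq_trans (card_setU_le _ _) _; rewrite cI.
  apply: leq_trans (card_cover_nbh (t := t) _) _.
    by move=> b /setDP[_ bZ]; apply: notZ_small; rewrite in_setC.
  rewrite mulnC leq_mul2r; apply/orP; right; apply: leq_trans cCov.
  exact: subset_leq_card (subsetDl _ _).
(* The pool avoids [I] and everything within distance 2 of it, so positions of [A] and of other hubs
   are neither adjacent nor share a neighbour. Paths through hubs are handled by [H], the others by
   [Near]. *)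
pose pool := P :\: (Near :|: cover_nbh e2 H).
have poolP v : v \in pool -> [/\ v \in P, v \notin I, v \notin cover_nbh e2 I &
    v \notin cover_nbh e2 (cover_nbh e2 I)].
  rewrite inE !in_setU !negb_or => /andP[/andP[/andP[/andP[vI vC] vN] vH] vP]; split=> //.
  apply/negP => /bigcupP[b bC ebv]; have [bZ|bZ] := boolP (b \in Z).
    by case/negP: vH; apply/bigcupP; exists b => //; rewrite in_setI bC.
  by case/negP: vN; apply/bigcupP; exists b => //; rewrite in_setD bZ.
pose X' := X :\: A.
have cX' : #|X'| <= #|X| by apply: subset_leq_card (subsetDl _ _).
have n0 : 0 < n by move: (n_ge166 bnd); clear; lia.
have [b0 b0I] : exists b0, b0 \in I by apply/set0Pn; rewrite -card_gt0 cI.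
have [yA [injyA yAI]] : exists yA : T1 -> T2, {in A &, injective yA} /\ forall a, a \in A -> yA a \in I.
  have [->|A0] := eqVneq A set0.
    by exists (fun=> b0); split=> [a b|a]; rewrite inE.
  by apply: card_le_inj A0; rewrite cI; case: cA => [|[]] // /leq_trans; apply.
(* The hubs other than [z1] and the non-hubs are monitored separately: a saturated hub removes up to
   as many pool vertices as touch [z1], a saturated non-hub at most [t]. *)
have [||y' [injy' py' cy' ly']] := @place_hubs _ _ e1 e2 irr1 sym1 sym2 X' (fun=> pool)
    (Z :\ z1) (~: Z) 2 1 1 (n %/ 2) _ _ yA.
- move=> x v _ /poolP[/pool1P[vZ v1 vf v2] _ _ _]; split=> //; last by rewrite -setDE.
  by rewrite -v1; apply/subset_leq_card/setIS/subsetDl.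
- move=> x B1 B2 j _ sB1 sB2 js sg bs.
  have cB2 : #|cover_nbh e2 B2| <= t * #|B2|.
    by apply: card_cover_nbh => b /(subsetP sB2); apply: notZ_small.
  have mono b : b * (n %/ 2 - #|X|) <= b * (n %/ 2 - #|X'|).
    by rewrite leq_mul2l leq_sub2l ?orbT.
  rewrite mul1n in sg; rewrite mul1n in bs.
  have B1Z z : z \in B1 -> z \in Z /\ z != z1 by move/(subsetP sB1)/setD1P=> [].
  (* In the first case the pool neighbours of [z1] suffice: they have no other hub neighbour, so
     neither [B1] nor [H], which miss [z1], removes any of them. *)
  have [room|room] := room_pool1 t_le t_gt bnd le21 X_le Z_le few0
     (#|nbh e2 z1 :&: P|) card_pool1 js (leq_trans (mono _) sg) (leq_trans (mono _) bs).
    apply: (@leq_trans #|(nbh e2 z1 :&: P) :\: (Near :|: cover_nbh e2 B2)|).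
      apply: card_setD_gt; apply: leq_ltn_trans room.
      by move: (card_setU_le Near (cover_nbh e2 B2)) cNear cB2 cX'; clear; lia.
    apply/subset_leq_card/subsetP=> v /setDP[/setIP[ez1v vP]]; rewrite in_nbh in ez1v.
    rewrite in_setU negb_or => /andP[vN vB2].
    have only_z1 z : z \in Z -> z != z1 -> ~~ e2 z v.
      move=> zZ; apply: contraNN => ezv; apply/eqP; apply: (pool1_hub_unique vP) => //; by rewrite sym2.
    rewrite in_setD in_setU negb_or vB2 andbT in_setD vP andbT in_setU negb_or vN /=.
    apply/andP; split; apply/negP => /bigcupP[h].
      by move=> /B1Z[hZ hz1]; rewrite in_nbh (negPf (only_z1 h hZ hz1)).
    case/setIP=> hC hZ; have hz1 : h != z1 by apply: contraNneq z1I => <-.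
    by rewrite in_nbh (negPf (only_z1 h hZ hz1)).
  have cB1 : #|P :&: cover_nbh e2 B1| <= #|B1| * #|nbh e2 z1 :&: P|.
    rewrite /cover_nbh big_distrr /=; apply: leq_trans (card_bigcup_le _ _) _.
    by rewrite -sum_nat_const; apply: leq_sum => z /B1Z[/maxz1]; rewrite setIC.
  apply: (@leq_trans #|P :\: (Near :|: (P :&: cover_nbh e2 H) :|: (P :&: cover_nbh e2 B1) :|: cover_nbh e2 B2)|).
    apply: card_setD_gt; apply: leq_ltn_trans room.
    set S1 := P :&: _ in cH *; set S2 := P :&: _ in cB1 *.
    move: (card_setU_le (Near :|: S1 :|: S2) (cover_nbh e2 B2)) (card_setU_le (Near :|: S1) S2).
    move: (card_setU_le Near S1) cNear cB2 cX' cB1 cH.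
    rewrite -[#|B1|.+2]add2n mulnDl.
    by move: (#|B1| * _); clear; lia.
  apply/subset_leq_card/subsetP=> v /setDP[vP]; rewrite !in_setU !in_setI vP /=.
  by rewrite !negb_or !in_setD vP !in_setU !negb_or => /andP[/andP[/andP[-> ->] ->] ->].
pose y x := if x \in A then yA x else y' x.
have yAE x : x \in A -> y x = yA x by rewrite /y => ->.
have yX'E x : x \in X' -> y x = y' x by rewrite /y => /setDP[_ /negPf->].
have splitX x : x \in X -> x \in A \/ x \in X'.
  by move=> xX; have [xA|xA] := boolP (x \in A); [left|right; rewrite inE xA].
have y'P x : x \in X' -> [/\ y' x \in P, y' x \notin I, y' x \notin cover_nbh e2 I &
    y' x \notin cover_nbh e2 (cover_nbh e2 I)] by move=> /py'/poolP.
have sep x b : x \in X' -> b \in cover_nbh e2 I -> ~~ e2 (y' x) b.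
  move=> /y'P[_ _ _ yC] bC; apply: contra yC => eyb; apply/bigcupP; exists b => //.
  by rewrite in_nbh sym2.
have loadE b : b \notin cover_nbh e2 I ->
    [set x in X | e2 (y x) b] = [set x in X' | e2 (y' x) b].
  move=> bC; apply/setP=> x; rewrite [LHS]inE [RHS]inE; apply/andP/andP=> -[xX eb].
    have [xA|xX'] := splitX x xX; last by rewrite -(yX'E _ xX').
    by case/negP: bC; apply/bigcupP; exists (y x); rewrite ?(yAE _ xA) ?yAI // in_nbh -(yAE _ xA).
  by rewrite yX'E //; split=> //; case/setDP: xX.
have load_le b : b \notin cover_nbh e2 I ->
    load e1 e2 X X y b <= load e1 e2 X' X' y' b.
  move=> bC; rewrite /load.
  rewrite (eq_bigl (fun x => x \in [set x in X | e2 (y x) b])); last by move=> x; rewrite inE.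
  rewrite (loadE b bC) (eq_bigl (fun x => (x \in X') && e2 (y' x) b)); last by move=> x; rewrite inE.
  by apply: leq_sum => x _; apply/subset_leq_card/setDS/subsetDl.
have touchA b : b \in cover_nbh e2 I -> [set x in X | e2 (y x) b] \subset A.
  move=> bC; apply/subsetP=> x; rewrite inE => /andP[xX eb].
  have [//|xX'] := splitX x xX; move: eb; rewrite yX'E //.
  by rewrite (negPf (sep _ _ xX' bC)).
exists y; split; first split.
- move=> a b /splitX[aA|aX'] /splitX[bA|bX'].
  + by rewrite !yAE //; apply: injyA.
  + rewrite (yAE _ aA) (yX'E _ bX') => eq_y; have [_ bI _ _] := y'P _ bX'.
    by rewrite -eq_y yAI in bI.
  + rewrite (yAE _ bA) (yX'E _ aX') => eq_y; have [_ aI _ _] := y'P _ aX'.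
    by rewrite eq_y yAI in aI.
  + by rewrite !yX'E //; apply: injy'.
- move=> x /splitX[xA|xX'].
    by rewrite yAE //; have [_ v11] := IP _ (yAI x xA); split=> //; apply: low_notin_hubs.
  rewrite yX'E //; have [/pool1P[vZ _ _ v2] _ _ _] := y'P _ xX'.
  by split=> //; apply: leq_trans v2 _.
- move=> a b /splitX[aA|aX'] /splitX[bA|bX'] eab.
  + by rewrite !yAE //; apply: indI; apply: yAI.
  + rewrite (yAE _ aA) (yX'E _ bX'); have [_ _ bC _] := y'P _ bX'; apply: contra bC => e2ab.
    by apply/bigcupP; exists (yA a); rewrite ?yAI ?in_nbh.
  + rewrite (yAE _ bA) (yX'E _ aX'); have [_ _ aC _] := y'P _ aX'; apply: contra aC => e2ab.
    by apply/bigcupP; exists (yA b); rewrite ?yAI ?in_nbh // sym2.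
  + by rewrite !yX'E //; apply: cy'.
- by move=> x xA; rewrite yAE //; have [] := IP _ (yAI x xA).
- move=> b bz1; have [bC|bC] := boolP (b \in cover_nbh e2 I).
    have leA := subset_leq_card (touchA b bC).
    have [A1|[A2 D4]] := cA; [by right; apply: leq_trans A1|left].
    apply: (@leq_trans (\sum_(x in X | e2 (y x) b) D)).
      by apply: leq_sum => x _; apply: leq_trans (D1 x); apply: subset_leq_card (subsetDl _ _).
    rewrite sum_nat_const; apply: (@leq_trans (2 * D)); last by move: D4; clear; lia.
    rewrite leq_mul2r; apply/orP; right; apply: leq_trans A2; apply: leq_trans leA.
    by rewrite cardsE.
  have [|leb|c1] := ly' b.
  + by rewrite in_setU in_setD1 bz1 in_setC /=; case: (b \in Z).
  + by left; apply: leq_trans (load_le b bC) leb.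
  + by right; rewrite (loadE b bC).
(* The 22 allows for the neighbours of [I], which may be heavy because of [A]; elsewhere the load
   comes from [X'] only. *)
exists #|[set b in ~: Z | n < 5 * load e1 e2 X' X' y' b]|.
  apply: (@leq_trans #|[set b in ~: Z | n < 5 * load e1 e2 X' X' y' b] :|: cover_nbh e2 I|).
    apply/subset_leq_card/subsetP=> b /setIdP[bZ heavy]; apply/setUP.
    have [bC|bC] := boolP (b \in cover_nbh e2 I); [by right|left].
    apply/setIdP; split=> //; apply: leq_trans heavy _; rewrite leq_mul2l /=; exact: load_le.
  by apply: leq_trans (card_setU_le _ _) _; rewrite leq_add2l.
have := @heavy_count _ _ e1 e2 X' sym1 (~: Z) 1 y' n; rewrite mul1n; apply=> x xX'.
by have [/pool1P[_ _ vf _] _ _ _] := y'P _ xX'; rewrite -setDE.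
Qed.

(** [z1] is sent to [w0]. Any other [z] has its own pool, avoiding the neighbours of the hubs placed
    next to [z]; the bound on the load of [z], or its single touching hub, keeps that pool large. *)
Lemma place_Z z1 w0 (y : T1 -> T2) : z1 \in Z -> w0 \notin X -> #|nbh e1 w0| <= 11 ->
  (forall x, x \in X -> e1 x w0 -> ~~ e2 (y x) z1) ->
  (forall b, b != z1 ->
     load e1 e2 X X y b <= n %/ 2 \/ #|[set x in X | e2 (y x) b]| <= 1) ->
  exists w : T2 -> T1,
    [/\ {in Z &, injective w},
        forall z, z \in Z -> w z \notin X /\ #|nbh e1 (w z)| <= 11,
        forall z z', z \in Z -> z' \in Z -> e2 z z' -> ~~ e1 (w z) (w z'),
        forall x z, x \in X -> z \in Z -> e1 x (w z) -> ~~ e2 (y x) z &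
        forall u, u \notin X -> load e2 e1 Z Z w u <= maxn (n %/ 2) D] /\
    exists2 c, #|[set u in ~: X | n < 5 * load e2 e1 Z Z w u]| <= c + 11 &
      2 * (n * c) <= 5 * (11 * degsum e2).
Proof.
move=> z1Z w0X w11 w0P ly.
(* With [Near] avoided, a neighbour of [w0] outside [X] is touched by [z1] alone. *)
pose Near := w0 |: nbh e1 w0 :|: cover_nbh e1 (nbh e1 w0 :\: X).
have cNear : #|Near| <= 12 + 11 * t.
  apply: leq_trans (card_setU_le _ _) (leq_add _ _).
    apply: leq_trans (card_setU_le _ _) _; by rewrite cards1 add1n; exact: w11.
  apply: leq_trans (card_cover_nbh (t := t) _) _.
    by move=> b /setDP[_ bX]; apply: notX_small; rewrite in_setC.
  rewrite mulnC leq_mul2r; apply/orP; right; apply: leq_trans w11.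
  exact: subset_leq_card (subsetDl _ _).
pose touching z := [set x in X | e2 (y x) z].
pose pool z := low e1 :\: (Near :|: cover_nbh e1 (touching z)).
pose Z' := Z :\ z1.
have cZ' : #|Z'| <= #|Z| by apply: subset_leq_card (subsetDl _ _).
have lowX v : v \in low e1 -> v \notin X by rewrite inE => v11; apply: low_notin_hubs.
have [||w' [injw' pw' cw' lw']] := @place_hubs _ _ e2 e1 irr2 sym2 sym1 Z' pool set0 (~: X) 11 0 11 (n %/ 2) _ _ (fun=> w0).
- move=> z v _ /setDP[]; rewrite inE => v11 _; split=> //; first by rewrite setI0 cards0.
  by apply: leq_trans v11; apply: subset_leq_card (subsetIl _ _).
- move=> z B1 B2 j zZ' sB1 sB2 js _ bs.
  have cB2 : #|cover_nbh e1 B2| <= t * #|B2|.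
    by apply: card_cover_nbh => b /(subsetP sB2); apply: notX_small.
  have -> : B1 = set0 by apply/eqP; rewrite -subset0.
  rewrite cover_nbh0 set0U.
  have bs' : #|B2| * (n %/ 2 - #|Z|) <= 11 * degsum e2.
    by apply: leq_trans bs; rewrite leq_mul2l leq_sub2l ?orbT.
  have z_z1 : z != z1 by case/setD1P: zZ'.
  apply: (@leq_trans #|low e1 :\: (cover_nbh e1 (touching z) :&: low e1) :\: (Near :|: cover_nbh e1 B2)|); last first.
    apply/subset_leq_card/subsetP=> v; rewrite !in_setD !in_setU in_setI !negb_or.
    by case/andP=> /andP[-> ->] /andP[vT vl]; move: vT; rewrite vl !andbT => ->.
  apply: card_setD_gt.
  have cU := card_setU_le Near (cover_nbh e1 B2).
  (* [h] bounds the vertices lost, by high degree or by adjacency to a hub touching [z]. For a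
     single touching hub [x], the high degrees are counted outside its closed neighbourhood only. *)
  have [h [hlow room]] : exists h, n <= h + #|low e1 :\: (cover_nbh e1 (touching z) :&: low e1)| /\
      #|Z| + 11 * j + (12 + 11 * t) + t * #|B2| + h < n.
    have single d h' : 12 * h' + 2 * d <= degsum e1 -> d <= D ->
        #|Z| + 11 * j + (12 + 11 * t) + t * #|B2| + h' + d.+1 < n.
      by move=> hd dD; apply: (room_far_single t_le t_gt bnd le21 Z_le Dn few0 hd dD js bs').
    have small_load : load e1 e2 X X y z <= n %/ 2 -> exists h, n <= h + #|low e1 :\: (cover_nbh e1 (touching z) :&: low e1)| /\
      #|Z| + 11 * j + (12 + 11 * t) + t * #|B2| + h < n.
      move=> ld; have [h h12 low_n] := card_low1.
      exists (h + n %/ 2); split; last by rewrite addnA; apply: (room_far t_le t_gt bnd le21 Z_le few0 h12 js bs').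
      apply: leq_trans low_n _; rewrite -addnA leq_add2l.
      rewrite -(cardsID (cover_nbh e1 (touching z) :&: low e1) (low e1)) leq_add2r.
      apply: leq_trans ld; apply: (@leq_trans #|cover_nbh e1 (touching z) :\: X|).
        apply/subset_leq_card/subsetP=> v /setIP[vl /setIP[vC _]].
        by rewrite in_setD vC lowX.
      have -> : cover_nbh e1 (touching z) :\: X = \bigcup_(x in touching z) (nbh e1 x :\: X).
        by rewrite setDE big_distrl; apply: eq_bigr => x _; rewrite setDE.
      apply: leq_trans (card_bigcup_le _ _) _; rewrite /load /weight.
      by rewrite (eq_bigl (fun x => (x \in X) && e2 (y x) z)) // => x; rewrite [LHS]inE.
    have [ld|c1] := ly z z_z1; first exact: (small_load ld).
    have [touch0|[x xT]] := set_0Vmem (touching z).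
      apply: small_load; rewrite /load.
      rewrite (eq_bigl (fun x => x \in touching z)); last first.
        by move=> x; apply/andP/setIdP.
      by rewrite touch0 big_set0.
    have touchE : touching z = [set x].
      by apply/eqP; rewrite eq_sym eqEcard sub1set xT cards1.
    pose far := ~: (x |: nbh e1 x); pose High := [set v in far | 12 <= #|nbh e1 v|].
    have cHigh : #|High| * 12 <= \sum_(v in far) #|nbh e1 v| by apply: markov_card.
    have hd : 12 * #|High| + 2 * #|nbh e1 x| <= degsum e1.
      by move: cHigh (sum_far_degrees irr1 sym1 x); rewrite -/far; clear; lia.
    exists (#|High| + #|nbh e1 x|.+1); split; last by rewrite addnA; apply: single.
    have cfar : #|far| + #|nbh e1 x| + 1 = n.
      by rewrite -cT1 -(cardsC (x |: nbh e1 x)) cardsU1 inE irr1 /far; lia.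
    have : #|far| <= #|High| + #|low e1 :\: (cover_nbh e1 (touching z) :&: low e1)|.
      apply: leq_trans (card_setU_le _ _); apply/subset_leq_card/subsetP=> v vfar.
      apply/setUP; have [d12|d11] := leqP 12 #|nbh e1 v|; [left|right].
        by rewrite inE vfar.
      have vlow : v \in low e1 by rewrite inE -ltnS.
      rewrite in_setD vlow andbT in_setI vlow andbT touchE.
      move: vfar; rewrite !inE negb_or => /andP[_ exv].
      by apply/negP => /bigcupP[x' /set1P->]; rewrite inE (negPf exv).
    by move: cfar; clear; lia.
  by move: hlow room cU cNear cB2 cZ'; clear; lia.
pose w z := if z == z1 then w0 else w' z.
have wz1 : w z1 = w0 by rewrite /w eqxx.
have wE z : z \in Z' -> w z = w' z by rewrite /w => /setD1P[/negPf->].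
have splitZ z : z \in Z -> z = z1 \/ z \in Z'.
  by move=> zZ; have [->|zz1] := eqVneq z z1; [left|right; rewrite in_setD1 zz1].
have w'P z : z \in Z' -> [/\ #|nbh e1 (w' z)| <= 11, w' z != w0, ~~ e1 w0 (w' z),
    forall u, u \notin X -> e1 w0 u -> ~~ e1 (w' z) u &
    forall x, x \in X -> e2 (y x) z -> ~~ e1 x (w' z)].
  move=> /pw'/setDP[]; rewrite inE => v11; rewrite !in_setU !negb_or in_set1 in_nbh.
  case/andP=> /andP[/andP[v0 ev0] vC] vT; split=> // [u uX eu|x xX eyz].
    apply: contra vC => evu; apply/bigcupP; exists u; rewrite ?in_nbh ?in_setD ?uX ?in_nbh //.
    by rewrite sym1.
  apply: contra vT => exv; apply/bigcupP; exists x; rewrite ?in_nbh //.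
  by apply/setIdP.
have touch1 u : u \notin X -> e1 w0 u -> forall z, z \in Z -> e1 (w z) u -> z = z1.
  move=> uX eu z /splitZ[//|zZ']; rewrite (wE _ zZ').
  by have [_ _ _ /(_ u uX eu)/negPf->] := w'P _ zZ'.
have loadE u : ~~ e1 w0 u -> load e2 e1 Z Z w u <= load e2 e1 Z' Z' w' u.
  move=> eu; rewrite /load.
  rewrite (eq_bigl (fun z => (z \in Z') && e1 (w' z) u)); last first.
    move=> z; apply/andP/andP=> -[zZ ez].
      have [zz1|zZ'] := splitZ z zZ; last by rewrite -(wE _ zZ').
      by rewrite zz1 wz1 (negPf eu) in ez.
    by rewrite wE //; split=> //; case/setD1P: zZ.
  by apply: leq_sum => z _; apply/subset_leq_card/setDS/subsetDl.
exists w; split; first split.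
- move=> a b /splitZ[->|aZ'] /splitZ[->|bZ'] //; rewrite ?wz1 ?wE //.
  + by move=> eq_w; have [_] := w'P _ bZ'; rewrite -eq_w eqxx.
  + by move=> eq_w; have [_] := w'P _ aZ'; rewrite eq_w eqxx.
  + exact: injw'.
- move=> z /splitZ[->|zZ']; first by rewrite wz1.
  by rewrite (wE _ zZ'); have [v11] := w'P _ zZ'; split=> //; apply: low_notin_hubs.
- move=> a b /splitZ[->|aZ'] /splitZ[->|bZ'] eab; rewrite ?wz1.
  + by rewrite irr2 in eab.
  + by rewrite (wE _ bZ'); have [_ _] := w'P _ bZ'.
  + by rewrite (wE _ aZ') sym1; have [_ _] := w'P _ aZ'.
  + by rewrite !wE //; apply: cw'.
- move=> x z xX /splitZ[->|zZ']; first by rewrite wz1; apply: w0P.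
  rewrite (wE _ zZ') => exw; have [_ _ _ _ /(_ x xX) wT] := w'P _ zZ'.
  by apply: contraL exw.
- move=> u uX; have [eu|eu] := boolP (e1 w0 u).
    rewrite leq_max; apply/orP; right; apply: load_single => //.
    apply: leq_trans (eq_leq (cards1 z1)); apply/subset_leq_card/subsetP=> z /setIdP[zZ ez].
    by rewrite inE (touch1 u uX eu z zZ ez).
  apply: leq_trans (loadE u eu) _; have [|leu|c1] := lw' u; first by rewrite set0U in_setC.
    by rewrite leq_max leu.
  by rewrite leq_max; apply/orP; right; apply: load_single.
exists #|[set u in ~: X | n < 5 * load e2 e1 Z' Z' w' u]|.
  apply: (@leq_trans #|[set u in ~: X | n < 5 * load e2 e1 Z' Z' w' u] :|: nbh e1 w0|).
    apply/subset_leq_card/subsetP=> u /setIdP[uX heavy]; apply/setUP.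
    have [eu|eu] := boolP (e1 w0 u); [by right; rewrite in_nbh|left].
    apply/setIdP; split=> //; apply: leq_trans heavy _; rewrite leq_mul2l /=; exact: loadE.
  by apply: leq_trans (card_setU_le _ _) _; rewrite leq_add2l.
apply: heavy_count => // z zZ'; have [v11 _ _ _ _] := w'P _ zZ'.
by apply: leq_trans v11; apply: subset_leq_card (subsetIl _ _).
Qed.

Lemma few_pool0_packable : packable e1 e2.
Proof.
have [z1 z1Z maxz1] := top_hub.
have [w0 [w0X w11 cA]] := seed.
have [y [[injy yP yy yA ly] [cb heavy_b cb_le]]] := place_X z1Z maxz1 (subsetIr (nbh e1 w0) X) cA.
have w0P x : x \in X -> e1 x w0 -> ~~ e2 (y x) z1.
  by move=> xX exw; apply: yA; rewrite in_setI in_nbh sym1 exw.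
have [w [[injw wP ww yw lw] [cu heavy_u cu_le]]] := place_Z z1Z w0X w11 w0P ly.
have ccount : 2 * (n * (cu + cb)) <= 5 * degsum e1 + 55 * degsum e2.
  by move: cu_le cb_le; rewrite mulnDr; clear; lia.
(* [33 = 22 + 11]: the neighbours of the two spared vertices and those of [w0]. *)
apply: (@hub_completion _ _ e1 e2 y w t (cu + cb + 33) 11 (maxn (n %/ 2) D) n) => //.
- move=> b bZ; have [|leb|c1] := ly b; first by apply: contraNneq bZ => ->.
    by rewrite leq_max leb.
  by rewrite leq_max; apply/orP; right; apply: load_single.
- by apply: leq_trans (leq_add heavy_u heavy_b) _; clear; lia.
- exact: (room_final1 t_le t_gt bnd le21 X_le Z_le D1s Dn few0 ccount).
- exact: (room_final_space33 t_le t_gt bnd le21 X_le Z_le ccount).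
Qed.

End NoDominating.

(** * Assembling the cases and the induction *)

Lemma square_root n : exists t, 5 * (t * t) <= n /\ n < 5 * (t.+1 * t.+1).
Proof.
have ex0 : exists t, 5 * (t * t) <= n by exists 0.
have bounded t : 5 * (t * t) <= n -> t <= n by move=> le_t; nia.
case: (ex_maxnP ex0 bounded) => t le_t max_t; exists t; split=> //.
by rewrite ltnNge; apply/negP => /max_t; rewrite ltnn.
Qed.

Lemma no_dominating_packable (T1 T2 : finType) (e1 : rel T1) (e2 : rel T2) n D :
  irreflexive e1 -> symmetric e1 -> irreflexive e2 -> symmetric e2 ->
  #|T1| = n -> #|T2| = n ->
  (forall v, #|nbh e1 v| <= D) -> (forall v, #|nbh e2 v| <= D) ->
  2 * D <= maxn (degsum e1) (degsum e2) ->
  degsum e1 + degsum e2 + 2 * D + 2 * C_const <= 6 * n -> 20 * D <= 19 * n ->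
  packable e1 e2.
Proof.
rewrite C_constE.
wlog le21 : T1 T2 e1 e2 / degsum e2 <= degsum e1.
  move=> hw irr1 sym1 irr2 sym2 cT1 cT2 D1 D2 Ds bnd Dn.
  have [le21|/ltnW le12] := leqP (degsum e2) (degsum e1); first exact: (hw _ _ e1 e2).
  apply: packable_swap; apply: (hw _ _ e2 e1) => //; first by rewrite maxnC.
  by rewrite [degsum e2 + _]addnC.
move=> irr1 sym1 irr2 sym2 cT1 cT2 D1 D2; rewrite (maxn_idPl le21) => Ds bnd Dn.
have [t [t_le t_gt]] := square_root n.
have [big0|few0] := leqP n (12 * #|pool0 e2 (hubs e2 t)|).
  exact: (pool0_packable irr1 sym1 irr2 sym2 cT1 cT2 D1 D2 Ds le21 bnd Dn t_le t_gt big0).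
exact: (few_pool0_packable irr1 sym1 irr2 sym2 cT1 cT2 D1 D2 Ds le21 bnd Dn t_le t_gt few0).
Qed.

Lemma packing_bound_all n : packing_bound n.
Proof.
elim/ltn_ind: n => n IHn T1 T2 e1 e2 D irr1 sym1 irr2 sym2 cT1 cT2 D1 D2 n1 n2 bnd.
have n0 : 0 < n by move: bnd; rewrite C_constE; clear; lia.
have T10 : 0 < #|T1| by rewrite cT1.
have T20 : 0 < #|T2| by rewrite cT2.
have [x mx] := eq_bigmax (fun v => #|nbh e1 v|) T10.
have [y my] := eq_bigmax (fun v => #|nbh e2 v|) T20.
have lex v : #|nbh e1 v| <= #|nbh e1 x| by rewrite -mx; apply: (leq_bigmax v).
have ley v : #|nbh e2 v| <= #|nbh e2 y| by rewrite -my; apply: (leq_bigmax v).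
have xD := D1 x; have yD := D2 y.
have sx := degree_le_degsum x irr1 sym1; have sy := degree_le_degsum y irr2 sym2.
(* [D] is only an upper bound, so it is replaced by the largest degree, attained at [x] or at [y],
   before comparison with [19 * n / 20]. *)
have [lexy|ltxy] := leqP #|nbh e2 y| #|nbh e1 x|.
  have le2 v : #|nbh e2 v| <= #|nbh e1 x| by apply: leq_trans (ley v) lexy.
  have bnd' : degsum e1 + degsum e2 + 2 * #|nbh e1 x| + 2 * C_const <= 6 * n.
    by move: bnd xD; clear; lia.
  have [small|large] := leqP (20 * #|nbh e1 x|) (19 * n).
    apply: (no_dominating_packable irr1 sym1 irr2 sym2 cT1 cT2 lex le2) => //.
    by rewrite leq_max sx.
  exact: (dominating IHn irr1 sym1 irr2 sym2 cT1 cT2 lex le2 (erefl _) (n1 x) bnd' (ltnW large)).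
have le1 v : #|nbh e1 v| <= #|nbh e2 y| by apply: leq_trans (lex v) (ltnW ltxy).
have bnd' : degsum e1 + degsum e2 + 2 * #|nbh e2 y| + 2 * C_const <= 6 * n.
  by move: bnd yD; clear; lia.
have [small|large] := leqP (20 * #|nbh e2 y|) (19 * n).
  apply: (no_dominating_packable irr1 sym1 irr2 sym2 cT1 cT2 le1 ley) => //.
  by rewrite leq_max sy orbT.
rewrite [degsum e1 + _]addnC in bnd'.
apply: packable_swap.
exact: (dominating IHn irr2 sym2 irr1 sym1 cT2 cT1 ley le1 (erefl _) (n2 y) bnd' (ltnW large)).
Qed.

Lemma degsum_nedges n (e : rel 'I_n) : irreflexive e -> symmetric e -> degsum e = 2 * nedges e.
Proof.
move=> irr sym; pose E := [set p : 'I_n * 'I_n | e p.1 p.2].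
have -> : degsum e = #|E|.
  rewrite /degsum -sum1_card (eq_bigr (fun x => \sum_(y | e x y) 1)); last first.
    by move=> x _; rewrite -sum1_card; apply: eq_bigl => y; rewrite inE.
  by rewrite pair_big_dep /=; apply: eq_bigl => -[x y]; rewrite inE.
pose swap (p : 'I_n * 'I_n) := (p.2, p.1).
have swapK : involutive swap by case.
rewrite -(cardsID [set p : 'I_n * 'I_n | (p.1 < p.2)%N] E) mul2n -addnn; congr (_ + _).
  by congr #|pred_of_set _|; apply/setP=> p; rewrite !inE andbC.
rewrite /nedges -[RHS](card_imset _ (inv_inj swapK)); congr #|pred_of_set _|.
apply/setP=> -[x y]; apply/idP/imsetP=> [|[[a b]]].
  rewrite !inE /= -leqNgt => /andP[le_yx exy]; exists (y, x) => //.
  rewrite inE /= sym exy ltn_neqAle le_yx !andbT.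
  by apply: contraTneq exy => /val_inj->; rewrite irr.
by rewrite !inE /= => /andP[lt_ab eab] [-> ->]; rewrite sym eab -leqNgt ltnW.
Qed.

Theorem mainTheorem1 (n : nat) (e1 e2 : rel 'I_n) :
  simple_graph e1 -> simple_graph e2 ->
  maxdeg e1 <= n - 2 -> maxdeg e2 <= n - 2 ->
  nedges e1 + nedges e2 + maxn (maxdeg e1) (maxdeg e2) + C_const <= 3 * n ->
  packs e1 e2.
Proof.
move=> [irr1 sym1] [irr2 sym2] max1 max2 bnd.
have {}irr1 : irreflexive e1 by move=> x; apply/negbTE.
have {}irr2 : irreflexive e2 by move=> x; apply/negbTE.
(* Needed to read the truncated [n - 2] as a true difference. *)
have n2 : 2 <= n by move: bnd; rewrite C_constE; clear; lia.
have deg1 x : #|nbh e1 x| <= maxdeg e1 by apply: (leq_bigmax x).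
have deg2 x : #|nbh e2 x| <= maxdeg e2 by apply: (leq_bigmax x).
have [||x|x|x|x||M [mM cM dM rM]] :=
  @packing_bound_all n _ _ e1 e2 (maxn (maxdeg e1) (maxdeg e2)) irr1 sym1 irr2 sym2.
- exact: card_ord.
- exact: card_ord.
- by apply: leq_trans (deg1 x) (leq_maxl _ _).
- by apply: leq_trans (deg2 x) (leq_maxr _ _).
- by have := leq_trans (deg1 x) max1; move: n2; clear; lia.
- by have := leq_trans (deg2 x) max2; move: n2; clear; lia.
- rewrite !degsum_nedges //; move: bnd; clear; lia.
have [f [injf fM]] := matching_fun mM dM.
exists f; split; first exact: injF_bij.
move=> u v e1uv; apply: (cM (u, f u) (v, f v)) => //; by rewrite fM.
Qed.
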